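(* Consider the planted submatrix problem with target $x=v_1$, and define $\kappa_\alpha$ as below. (i) If $0<r<1$, $\lambda\le\sqrt{\frac{r}{e\rho^2n}}$ and the integer $D\ge1$ satisfies $D\le\min\{\log_2(1/\rho)-1,\ \sqrt{\tfrac e3r\rho^2n}\}$, then $\mathrm{Corr}_{\le D}^2\le2\rho^2/(1-r)^2$. (ii) If the integer $D$ satisfies $1\le D\le\min\{\log_2(1/\rho)-1,\ n-1\}$, then \[ \sum_{\alpha\in\mathbb{N}^N,\ 0\le|\alpha|\le D}\frac{\kappa_\alpha^2}{\alpha!}\ge\frac{\rho^2}{4eD^{3/2}}\big[e\lambda^2\rho^2(n-D)\big]^D. \]
   Context: Planted submatrix problem: observe $Y=\lambda vv^\top+W$ ($n\times n$), $v\in\{0,1\}^n$ i.i.d. $\mathrm{Bernoulli}(\rho)$, $\rho\in(0,1)$, $\lambda\ge0$, $W$ symmetric with $W_{ij}=W_{ji}\sim\mathcal{N}(0,1)$ for $i<j$, $W_{ii}\sim\mathcal{N}(0,2)$, $\{W_{ij}:i\le j\}$ independent and independent of $v$. $\mathrm{Corr}_{\le D}=\sup\{\mathbb{E}[f(Y)x]/\sqrt{\mathbb{E}f(Y)^2}\}$ over real polynomials $f$ of degree $\le D$ in the entries of $Y$ with $\mathbb{E}f(Y)^2\ne0$. For $\kappa_\alpha$: $N=n(n+1)/2$ indexed by pairs $(i,j)$, $i\le j$; $X_{ij}=\lambda v_iv_j$; $\alpha\in\mathbb{N}^N$ with $|\alpha|=\sum\alpha_{ij}$, $\alpha!=\prod\alpha_{ij}!$,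 $X^\alpha=\prod X_{ij}^{\alpha_{ij}}$, $\binom\alpha\beta=\prod\binom{\alpha_{ij}}{\beta_{ij}}$, $\beta\le\alpha$ entrywise, $\beta\lneq\alpha$ meaning $\beta\le\alpha,\beta\ne\alpha$; $\kappa_\alpha=\mathbb{E}[v_1X^\alpha]-\sum_{0\le\beta\lneq\alpha}\kappa_\beta\binom\alpha\beta\mathbb{E}[X^{\alpha-\beta}]$. *)

(* Defs.v *)
From HB Require Import structures.
From mathcomp Require Import all_boot all_order all_algebra.
From mathcomp Require Import all_classical all_reals all_analysis.
Set Implicit Arguments.
Unset Strict Implicit.
Unset Printing Implicit Defensive.
Import Order.TTheory GRing.Theory Num.Theory.
Import numFieldNormedType.Exports.
Local Open Scope classical_set_scope.
Local Open Scope ring_scope.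

(* Index set of the N = n(n+1)/2 independent noise entries: pairs (i,j), i <= j *)
Definition pairT (n : nat) : predArgType := {p : 'I_n * 'I_n | (p.1 <= p.2)%N}.
HB.instance Definition _ n := [isSub for (@proj1_sig _ _ : pairT n -> _)].
HB.instance Definition _ n := [Finite of pairT n by <:].

Lemma pidx_proof n (i j : 'I_n) :
  ((if (i <= j)%N then (i, j) else (j, i)).1 <= (if (i <= j)%N then (i, j) else (j, i)).2)%N.
Proof. by case: (leqP i j) => //= /ltnW. Qed.

Definition pidx n (i j : 'I_n) : pairT n :=
  @exist _ (fun p : 'I_n * 'I_n => is_true (p.1 <= p.2)%N) _ (pidx_proof i j).

Section Model.
Variable R : realType.

Definition sdev n (p : pairT n) : R :=
  if (val p).1 == (val p).2 then Num.sqrt 2 else 1.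

(* Gaussian expectation over the independent entries listed in s
   (iterated integrals against the normal laws N(0, sdev^2)) *)
Fixpoint gauss_iter n (s : seq (pairT n)) (g : (pairT n -> R) -> R)
    (w : pairT n -> R) : R :=
  match s with
  | [::] => g w
  | t :: s' => Rintegral (normal_prob 0 (sdev t)) setT
      (fun y : R => gauss_iter s' g (fun u => if u == t then y else w u))
  end.

Definition EW n (g : (pairT n -> R) -> R) : R :=
  gauss_iter (enum (pairT n)) g (fun _ => 0).

Definition Ev n (rho : R) (h : {ffun 'I_n -> bool} -> R) : R :=
  \sum_(v : {ffun 'I_n -> bool})
     (\prod_(i < n) (if v i then rho else 1 - rho)) * h v.

Definition Yof n (lam : R) (v : {ffun 'I_n -> bool}) (w : pairT n -> R)
  : 'I_n -> 'I_n -> R :=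
  fun i j => lam * (v i)%:R * (v j)%:R + w (pidx i j).

Definition EvY n (rho lam : R) (g : {ffun 'I_n -> bool} -> ('I_n -> 'I_n -> R) -> R)
  : R := Ev rho (fun v => EW (fun w => g v (Yof lam v w))).

Definition polyD n (D : nat) (c : {ffun 'I_n * 'I_n -> 'I_D.+1} -> R)
  (Y : 'I_n -> 'I_n -> R) : R :=
  \sum_(a : {ffun 'I_n * 'I_n -> 'I_D.+1} | (\sum_(p : 'I_n * 'I_n) a p <= D)%N)
     c a * \prod_(p : 'I_n * 'I_n) Y p.1 p.2 ^+ a p.

Definition CorrD n (rho lam : R) (i0 : 'I_n) (D : nat) : R :=
  sup [set r : R | exists c : {ffun 'I_n * 'I_n -> 'I_D.+1} -> R,
        EvY rho lam (fun _ Y => polyD c Y ^+ 2) != 0 /\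
        r = EvY rho lam (fun v Y => polyD c Y * (v i0)%:R)
            / Num.sqrt (EvY rho lam (fun _ Y => polyD c Y ^+ 2))].

Definition Xpow n (lam : R) (v : {ffun 'I_n -> bool}) (a : {ffun pairT n -> nat}) : R :=
  \prod_(p : pairT n) (lam * (v (val p).1)%:R * (v (val p).2)%:R) ^+ a p.

Definition mbinom n (a b : {ffun pairT n -> nat}) : nat :=
  \prod_(p : pairT n) 'C(a p, b p).

Definition mfact n (a : {ffun pairT n -> nat}) : nat := \prod_(p : pairT n) (a p)`!.

Definition msize n (a : {ffun pairT n -> nat}) : nat := \sum_(p : pairT n) a p.

Definition ffnat n k (b : {ffun pairT n -> 'I_k}) : {ffun pairT n -> nat} :=
  [ffun p => nat_of_ord (b p)].

Definition ffsub n (a b : {ffun pairT n -> nat}) : {ffun pairT n -> nat} :=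
  [ffun p => (a p - b p)%N].

(* kappa with fuel k; the recursion ranges over all beta <= alpha, beta <> alpha
   (every such beta has entries <= |alpha|, hence is some ffnat b with
   b : {ffun pairT n -> 'I_(|alpha|+1)}, injectively) *)
Fixpoint kappa_fuel n (rho lam : R) (i0 : 'I_n) (k : nat)
    (a : {ffun pairT n -> nat}) : R :=
  match k with
  | 0 => 0
  | k'.+1 =>
      Ev rho (fun v => (v i0)%:R * Xpow lam v a)
      - \sum_(b : {ffun pairT n -> 'I_(msize a).+1} |
               [forall p, (b p <= a p)%N] && (ffnat b != a))
          kappa_fuel rho lam i0 k' (ffnat b) * (mbinom a (ffnat b))%:R
          * Ev rho (fun v => Xpow lam v (ffsub a (ffnat b)))
  end.

(* kappa_alpha for target x = v_{i0}; fuel |alpha|+1 suffices *)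
Definition kappa n (rho lam : R) (i0 : 'I_n) (a : {ffun pairT n -> nat}) : R :=
  kappa_fuel rho lam i0 (msize a).+1 a.

Definition kappa_sum n (rho lam : R) (i0 : 'I_n) (D : nat) : R :=
  \sum_(a : {ffun pairT n -> 'I_D.+1} | (msize (ffnat a) <= D)%N)
     kappa rho lam i0 (ffnat a) ^+ 2 / (mfact (ffnat a))%:R.

End Model.

(* Main.v *)
(** Let g(W) be the Hermite expansion of the noise with coefficients kappa_b,
    normalised so that E[g(W) f(Y)] = E[f(Y) x] for every polynomial f of degree at
    most D: by the heat-semigroup identity for Hermite polynomials this is exactly the
    recursion defining kappa.  Cauchy-Schwarz then bounds Corr^2 by E[g(W)^2], which is
    at most the sum of kappa_a^2 / a! (the diagonal variances only help).

    View a multi-index a as a multigraph, with v(a) its number of vertices, the root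
    included.  If a is not connected to the root then kappa_a = 0.  Otherwise every
    subtracted term of the recursion loses a factor rho, so that, as soon as
    2^(D+1) rho <= 1, kappa_a lies between 1/2 and 1 times lam^|a| rho^v(a).
    A connected multigraph contains a spanning tree, trees are counted by Cayley's
    formula, and the remaining edges contribute a factor
    (1 - lam^2)^(- number of pairs of vertices) <= 1 / (1 - r^2).  For the lower bound
    the trees with D edges alone suffice, by Stirling's inequality. *)

Require Import Defs.
From HB Require Import structures.
From mathcomp Require Import all_boot all_order all_algebra.
From mathcomp Require Import all_classical all_reals all_analysis.
From mathcomp Require Import measurable_realfun simple_functions.
From mathcomp Require Import ring lra zify.
Set SsrOldRewriteGoalsOrder.
Set Implicit Arguments.
Unset Strict Implicit.
Unset Printing Implicit Defensive.
Import Order.TTheory GRing.Theory Num.Theory.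
Import numFieldNormedType.Exports.
Local Open Scope classical_set_scope.
Local Open Scope ring_scope.

(** * Gaussian moments of polynomials *)

Section GaussianMoments.
Variable R : realType.
Local Notation mu := (@lebesgue_measure R).
Import HBNNSimple.

(** The normalisation of g succeeds for a formal reason. E[H_b(W) (W + X)^a] is, up to the norm of
    H_b, the divided b-th derivative at X of the noise average of (W + X)^a, and binom(a, b) X^(a-b)
    is the divided b-th derivative of X^a. Extended by linearity, the recursion for kappa thus reads
    E[x psi(X)] = sum_b kappa_b E[D^b psi(X)], and it is applied to the noise average psi of f. A
    factor rho is lost because, in a connected a = b + c with c nonzero, c shares a vertex with b or
    with the root, and kappa_b E[X^c] pays for that vertex twice. The binomials binom(a, b) total
    2^|a|, whence the condition on D. The noise expectation is an iterated integral of an arbitrary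
    function, so even its additivity needs an argument. The functions that have to be integrated are
    sums of products of univariate polynomials, on which it factorises pair by pair; Stein's
    identity then yields all Hermite computations. *)

Lemma ge0_integral_normal_prob (s : R) (f : _ -> \bar R) :
  measurable_fun setT f -> (forall x, 0 <= f x)%E ->
  (\int[normal_prob 0 s]_x f x = \int[mu]_x (f x * (normal_pdf 0 s x)%:E))%E.
Proof.
move=> mf f0.
have mpdf : measurable_fun setT (EFin \o normal_pdf (0:R) s).
  by apply/measurable_EFinP; exact: measurable_normal_pdf.
have pdf0 x : (0 <= (normal_pdf 0 s x)%:E)%E by rewrite lee_fin normal_pdf_ge0.
(* The usual ladder: indicators, nonnegative simple functions, monotone limits. *)
have Hind E : measurable E -> (\int[normal_prob 0 s]_x (\1_E x)%:E =
    \int[mu]_x ((\1_E x)%:E * (normal_pdf 0 s x)%:E))%E.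
  move=> mE; rewrite integral_indic//= setIT /normal_prob.
  rewrite [LHS]integral_mkcond/=; apply: eq_integral => x _.
  by rewrite patchE indicE; case: ifPn => _; rewrite ?mul1e ?mul0e.
have Hnn (h : {nnsfun (measurableTypeR R) >-> R}) : (\int[normal_prob 0 s]_x (h x)%:E =
    \int[mu]_x ((h x)%:E * (normal_pdf 0 s x)%:E))%E.
  have mh r : measurable (h @^-1` [set r]).
    exact: (measurable_funPTI h (measurable_set1 r)).
  have mi r : measurable_fun setT (\1_(h @^-1` [set r]) : measurableTypeR R -> R).
    exact: measurable_indic.
  have mei r : measurable_fun setT (fun x : measurableTypeR R => (\1_(h @^-1` [set r]) x : R)%:E).
    exact/measurable_EFinP.
  have mri r : measurable_fun setT (fun x : measurableTypeR R => (r * \1_(h @^-1` [set r]) x)%:E).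
    by apply/measurable_EFinP/measurable_funM.
  under [LHS]eq_integral do rewrite fimfunE -fsumEFin//.
  rewrite [LHS]ge0_integral_fsum//; last first.
    - by move=> n x _; rewrite EFinM nnfun_muleindic_ge0.
  under [RHS]eq_integral.
    move=> x _; rewrite fimfunE -fsumEFin// muleC ge0_mule_fsumr; last first.
      by move=> r; rewrite EFinM nnfun_muleindic_ge0.
    over.
  rewrite [RHS]ge0_integral_fsum//; last 2 first.
    - move=> r; apply: emeasurable_funM => //; exact: mri.
    - by move=> n x _; rewrite mule_ge0 // EFinM nnfun_muleindic_ge0.
  apply: eq_fsbigr => r _.
  have [r0|r0] := leP 0 r.
    transitivity (\int[mu]_x (r%:E * ((\1_(h @^-1` [set r]) x)%:E *
        (normal_pdf 0 s x)%:E)))%E; last first.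
      by apply: eq_integral => x _; rewrite muleA -EFinM muleC.
    under eq_integral do rewrite EFinM.
    rewrite ge0_integralZl//.
    rewrite ge0_integralZl//.
    - by congr (_ * _)%E; exact: (Hind _ (mh r)).
    - by apply: emeasurable_funM => //; exact: mei.
    - by move=> x _; rewrite mule_ge0// lee_fin.
  have -> : h @^-1` [set r] = set0.
    apply/seteqP; split => // x /= hx.
    have h0 : 0 <= h x by exact: fun_ge0.
    by move: h0; rewrite hx leNgt r0.
  by rewrite !integral0_eq// => x _; rewrite indic0 mulr0 ?mule0.
pose f_ := nnsfun_approx measurableT mf.
transitivity (lim (\int[normal_prob 0 s]_x (f_ n x)%:E @[n --> \oo])%E).
  rewrite -monotone_convergence//=.
  - apply: eq_integral => x _; apply/esym/cvg_lim => //=.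
    exact: cvg_nnsfun_approx.
  - by move=> n; exact/measurable_EFinP/measurable_funTS.
  - by move=> n ? _; rewrite lee_fin.
  - by move=> ? _ ? ? mn; rewrite lee_fin; exact/lefP/nd_nnsfun_approx.
transitivity (lim (\int[mu]_x ((f_ n x)%:E * (normal_pdf 0 s x)%:E) @[n --> \oo])%E).
  by apply: congr_lim; apply/funext => n /=; exact: Hnn.
rewrite -monotone_convergence//=.
- apply: eq_integral => x _; apply/cvg_lim => //=.
  apply: cvgeZr => //; exact: cvg_nnsfun_approx.
- by move=> n; apply: emeasurable_funM => //; exact/measurable_EFinP/measurable_funTS.
- by move=> n x _; rewrite mule_ge0// lee_fin.
- move=> x _ m n mn; apply: lee_pmul => //; rewrite lee_fin//.
  exact/lefP/nd_nnsfun_approx.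
Qed.

Lemma integrable_normal_prob (s : R) (f : R -> R) :
  measurable_fun setT f ->
  mu.-integrable setT (fun x => (f x * normal_pdf 0 s x)%:E) ->
  (normal_prob 0 s).-integrable setT (EFin \o f).
Proof.
move=> mf /integrableP[_ fi]; apply/integrableP; split; first exact/measurable_EFinP.
rewrite ge0_integral_normal_prob//; last first.
  by apply/measurable_EFinP; exact: measurableT_comp.
apply: le_lt_trans fi; rewrite le_eqVlt; apply/orP; left; apply/eqP.
apply: eq_integral => x _ /=; rewrite normrM EFinM.
by rewrite (ger0_norm (normal_pdf_ge0 _ _ _)).
Qed.

(** Both sides split into positive and negative parts, and a nonnegative density passes through the
    two maxima; integrability never enters. *)
Lemma Rintegral_normal_prob (s : R) (f : R -> R) :
  measurable_fun setT f ->
  Rintegral (normal_prob 0 s) setT f = Rintegral mu setT (fun x => f x * normal_pdf 0 s x).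
Proof.
move=> mf; rewrite /Rintegral; congr fine.
have mEf : measurable_fun setT (EFin \o f) by exact/measurable_EFinP.
rewrite integralE [RHS]integralE.
rewrite !ge0_integral_normal_prob//; last 2 first.
- exact: measurable_funeneg.
- exact: measurable_funepos.
by congr (_ - _)%E; apply: eq_integral => x _;
   rewrite ?funeposE ?funenegE /= -?EFinN -!EFin_max -EFinM maxr_pMl ?normal_pdf_ge0//
     mul0r ?mulNr.
Qed.

End GaussianMoments.

(** * Integrability of polynomials under the normal law and Stein's identity *)

Section PolynomialMoments.
Variable R : realType.
Local Notation mu := (@lebesgue_measure R).

(** Each Horner step spends half of the exponent: [|x| <= 1 + x^2] is absorbed by the exponential of
    [c/2 * x^2]. *)
Lemma poly_le_expR_sqr (p : {poly R}) (c : R) : 0 < c ->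
  exists2 C : R, 0 <= C & forall x : R, `|p.[x]| <= C * expR (c * x ^+ 2).
Proof.
elim/poly_ind: p c => [|p a IH] c c0.
  by exists 0 => // x; rewrite horner0 normr0 mul0r.
have c20 : 0 < c / 2 by rewrite divr_gt0.
have [C C0 HC] := IH _ c20.
exists (C * (1 + 2 / c) + `|a|).
  by rewrite addr_ge0// mulr_ge0// addr_ge0// divr_ge0// ltW.
move=> x; rewrite hornerMXaddC (le_trans (ler_normD _ _))// mulrDl lerD//; last first.
  by rewrite ler_peMr// -expR0 ler_expR mulr_ge0 ?sqr_ge0// ltW.
rewrite normrM.
have -> : c * x ^+ 2 = c / 2 * x ^+ 2 + c / 2 * x ^+ 2 by field.
rewrite expRD mulrACA ler_pM//.
have h1 : 1 + c / 2 * x ^+ 2 <= expR (c / 2 * x ^+ 2) by exact: expR_ge1Dx.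
have h2 : `|x| <= 1 + x ^+ 2.
  rewrite -real_normK ?num_real//.
  have := sqr_ge0 (`|x| - 1); have := normr_ge0 x; nra.
apply: (le_trans h2); apply: le_trans (_ : (1 + 2 / c) * (1 + c / 2 * x ^+ 2) <= _).
  have -> : (1 + 2 / c) * (1 + c / 2 * x ^+ 2) =
     1 + x ^+ 2 + (2 / c + c / 2 * x ^+ 2) by field; rewrite gt_eqF.
  have := divr_ge0 (ler0n R 2) (ltW c0).
  by have := mulr_ge0 (ltW c20) (sqr_ge0 x); lra.
by rewrite ler_pM2l// addr_gt0// divr_gt0.
Qed.

(** A Gaussian of twice the variance absorbs the polynomial; this gives both integrability and decay
    at infinity. *)
Lemma poly_normal_pdf_le (p : {poly R}) (s : R) : s != 0 ->
  exists2 C : R, 0 <= C &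
    forall x : R, `|p.[x] * normal_pdf 0 s x| <= C * normal_pdf 0 (Num.sqrt 2 * s) x.
Proof.
move=> s0.
have s2 : 0 < s ^+ 2 by rewrite exprn_even_gt0.
have sq2 : Num.sqrt 2 * s != 0 :> R by rewrite mulf_neq0// gt_eqF// sqrtr_gt0.
(* The rate [1/(4 s^2)] turns the exponent [-x^2/(2 s^2)] into [-x^2/(4 s^2)], that of standard
   deviation [sqrt 2 * s]. *)
have [C C0 HC] := @poly_le_expR_sqr p ((4 * s ^+ 2)^-1) (ltac:(rewrite invr_gt0 mulr_gt0//)).
exists (C * (normal_peak s / normal_peak (Num.sqrt 2 * s))).
  by rewrite mulr_ge0// divr_ge0// normal_peak_ge0.
move=> x; rewrite normrM (ger0_norm (normal_pdf_ge0 _ _ _)).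
apply: (le_trans (ler_wpM2r (normal_pdf_ge0 0 s x) (HC x))).
rewrite !normal_pdfE// -!mulrA ler_wpM2l// mulrCA ler_wpM2l ?normal_peak_ge0//.
rewrite mulKf ?gt_eqF ?normal_peak_gt0// /normal_fun -expRD ler_expR subr0.
rewrite exprMn sqr_sqrtr// le_eqVlt; apply/orP; left; apply/eqP.
by field.
Qed.

Lemma integrable_poly_normal_pdf (p : {poly R}) (s : R) : s != 0 ->
  mu.-integrable setT (fun x => (p.[x] * normal_pdf 0 s x)%:E).
Proof.
move=> s0; have [C C0 HC] := @poly_normal_pdf_le p s s0.
have mp : measurable_fun setT (horner p : R -> R).
  by apply: continuous_measurable_fun => x; exact: continuous_horner.
apply: (@le_integrable _ _ _ mu setT measurableT _
   (fun x => (C%:E * (normal_pdf 0 (Num.sqrt 2 * s) x)%:E)%E)).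
- by apply/measurable_EFinP/measurable_funM => //; exact: measurable_normal_pdf.
- move=> x _; rewrite -EFinM /= lee_fin (le_trans (HC x))//.
  exact: ler_norm.
- by apply: integrableZl => //; exact: integrable_normal_pdf.
Qed.

Lemma is_derive_normal_pdf (s x : R) : s != 0 ->
  is_derive x (1 : R) (normal_pdf 0 s) (- (x / s ^+ 2) * normal_pdf 0 s x).
Proof.
move=> s0; rewrite normal_pdfE// /normal_fun.
have -> : (fun x0 : R => normal_peak s * expR (- (x0 - 0) ^+ 2 / (s ^+ 2 *+ 2))) =
  (normal_peak s *: (expR \o (fun y : R => (- (s ^+ 2 *+ 2)^-1) *: (y ^+ 2 : R)))).
  by apply/funext => y /=; rewrite subr0; congr (_ * expR _); rewrite /GRing.scale/= !mulNr mulrC.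
apply: is_derive_eq.
rewrite /GRing.scale/= subr0.
have -> : - x ^+ 2 / (s ^+ 2 *+ 2) = - (s ^+ 2 *+ 2)^-1 * x ^+ 2 by rewrite !mulNr mulrC.
rewrite mulrCA; move: (expR _) => E; field.
by [].
Qed.


(** Only [|u n|] is prescribed, so that one statement serves both ends of the line. *)
Lemma cvg_poly_normal_pdf (p : {poly R}) (s : R) (u : nat -> R) : s != 0 ->
  (forall n, `|u n| = n.+1%:R) ->
  p.[u n] * normal_pdf 0 s (u n) @[n --> \oo] --> (0 : R).
Proof.
move=> s0 hu; have [C C0 HC] := @poly_normal_pdf_le p s s0.
set t := Num.sqrt 2 * s in HC.
have t0 : t != 0 by rewrite mulf_neq0// gt_eqF// sqrtr_gt0.
have t2 : 0 < t ^+ 2 by rewrite exprn_even_gt0.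
have d0 : 0 < t ^+ 2 *+ 2 by rewrite pmulrn_lgt0.
pose K := C * normal_peak t * (t ^+ 2 *+ 2).
have HK n : `|p.[u n] * normal_pdf 0 s (u n)| <= K * n.+1%:R^-1.
  apply: (le_trans (HC _)); rewrite normal_pdfE// /normal_fun subr0.
  rewrite /K -!mulrA ler_wpM2l// ler_wpM2l ?normal_peak_ge0//.
  rewrite -(real_normK (num_real _)) hu.
  have n1 : 1 <= n.+1%:R :> R by rewrite ler1n.
  rewrite mulNr expRN -[leRHS]invrK invfM invrK lef_pV2 ?posrE ?expR_gt0//; last first.
    by rewrite mulr_gt0// invr_gt0.
  apply: le_trans (expR_ge1Dx _).
  rewrite mulrC; apply: le_trans (_ : n.+1%:R ^+ 2 / (t ^+ 2 *+ 2) <= _); last lra.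
  by rewrite ler_wpM2r ?invr_ge0 ?(ltW d0)// expr2 ler_peMr.
apply: (@squeeze_cvgr _ _ _ _ (fun n => - (K * n.+1%:R^-1)) (fun n => K * n.+1%:R^-1)).
- by apply: nearW => n; rewrite -ler_norml.
- rewrite -oppr0 -(mulr0 K); apply: cvgN; apply: cvgMl_tmp; exact: cvg_harmonic.
- rewrite -(mulr0 K); apply: cvgMl_tmp; exact: cvg_harmonic.
Qed.

(** The integrand is the derivative of [s^2 p] times the density, whose boundary terms vanish. *)
Lemma integral_derive_poly_normal_pdf (p : {poly R}) (s : R) : s != 0 ->
  Rintegral mu setT
    (fun x => (s ^+ 2 *: p^`() - p * 'X).[x] * normal_pdf 0 s x) = 0.
Proof.
move=> s0; set q := s ^+ 2 *: p^`() - p * 'X.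
pose F x := (s ^+ 2 *: p).[x] * normal_pdf 0 s x.
pose f x := q.[x] * normal_pdf 0 s x.
have dF x : is_derive x (1 : R) F (f x).
  have h1 : is_derive x (1 : R) (horner (s ^+ 2 *: p)) (s ^+ 2 *: p)^`().[x] by exact: is_derive_poly.
  have h2 := @is_derive_normal_pdf s x s0.
  apply: (@is_derive_eq _ _ _ _ _ _ _ _ (is_deriveM h1 h2)).
  rewrite /f /q derivZ !hornerE.
  move: (p.[x]) (p^`().[x]) (normal_pdf 0 s x) => a b c.
  by rewrite /GRing.scale/= /GRing.scale/=; field.
have cf : continuous f.
  move=> x; apply: cvgM; first exact: continuous_horner.
  exact: continuous_normal_pdf.
have cF : continuous F.
  move=> x; apply: cvgM; first exact: continuous_horner.
  exact: continuous_normal_pdf.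
have fi : mu.-integrable setT (EFin \o f) by exact: integrable_poly_normal_pdf.
have mf : measurable_fun setT (EFin \o f) by exact: measurable_int fi.
pose D n : set (measurableTypeR R) := `[- (n.+1%:R : R), n.+1%:R]%classic.
pose f_ n := ((EFin \o f) \_ (D n)).
have mf_ n : measurable_fun setT (f_ n).
  have mD : measurable (D n) by exact: measurable_itv.
  by apply/(measurable_restrictT _ mD); exact: (measurable_funS measurableT (@subsetT _ (D n)) mf).
have f_f x : f_ ^~ x @ \oo --> (f x)%:E.
  apply: cvg_near_cst; near=> n; rewrite /f_ patchE ifT// inE /D/= in_itv/= -ler_norml.
  near: n; exists (Num.truncn `|x|).+1 => // n /=; rewrite -(ler_nat R) => h.
  by rewrite (le_trans (ltW (truncnS_gt _)))// (le_trans h)// ler_nat.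
have f_g n x : (`|f_ n x| <= `|(f x)%:E|)%E.
  by rewrite /f_ patchE; case: ifP => // _; rewrite abse0 abse_ge0.
(* The integrals over [[-(n+1), n+1]] have two limits: the full integral by domination, and 0 by the
   fundamental theorem of calculus. *)
have [_ _ lim1] := @dominated_convergence _ _ _ mu setT measurableT f_ (EFin \o f)
  (fun x => `|(f x)%:E|%E) mf_ mf (aeW _ (fun x _ => f_f x)) (integrable_abse fi)
  (aeW _ (fun x n _ => f_g n x)).
have lim2 : (\int[mu]_x f_ n x)%E @[n --> \oo] --> (0 : \bar R).
  rewrite (_ : (fun n => _) = (fun n => (F n.+1%:R - F (- n.+1%:R))%:E)); last first.
    apply/funext => n; rewrite /f_ -integral_mkcond.
    rewrite (@continuous_FTC2 _ f F).
    - by rewrite EFinB.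
    - by rewrite (@lt_trans _ _ 0)// oppr_lt0.
    - by apply: continuous_subspaceT.
    - split => [x _||]; first by have [] := dF x.
      + by apply: cvg_at_right_filter; exact: cF.
      + by apply: cvg_at_left_filter; exact: cF.
    - by move=> x _; rewrite derive1E; have [] := dF x.
  apply: cvg_EFin; first exact: nearW.
  rewrite -(subr0 0); apply: cvgB; apply: cvg_poly_normal_pdf => // n.
    by rewrite ger0_norm.
  by rewrite normrN ger0_norm.
by rewrite /Rintegral (cvg_unique _ lim1 lim2).
Unshelve. all: by end_near.
Qed.

End PolynomialMoments.

(** * Hermite polynomials and the noise expectation *)

Section GaussianFunctional.
Variable R : realType.
Implicit Types (s : R) (p q : {poly R}).

Definition gaussL s p : R := Rintegral (normal_prob 0 s) setT (horner p).

Lemma measurable_horner p : measurable_fun setT (horner p : R -> R).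
Proof. by apply: continuous_measurable_fun => x; exact: continuous_horner. Qed.

Lemma integrable_horner_normal_prob s p : s != 0 ->
  (normal_prob 0 s).-integrable setT (EFin \o horner p).
Proof.
move=> s0; apply: integrable_normal_prob; first exact: measurable_horner.
exact: integrable_poly_normal_pdf.
Qed.

Lemma gaussLD s p q : s != 0 -> gaussL s (p + q) = gaussL s p + gaussL s q.
Proof.
move=> s0; rewrite /gaussL (_ : horner (p + q) = (fun x => p.[x] + q.[x])).
  by rewrite RintegralD//; exact: integrable_horner_normal_prob.
by apply/funext => x; rewrite hornerD.
Qed.

Lemma gaussLZ s (c : R) p : s != 0 -> gaussL s (c *: p) = c * gaussL s p.
Proof.
move=> s0; rewrite /gaussL (_ : horner (c *: p) = (fun x => c * p.[x])).
  by rewrite RintegralZl//; exact: integrable_horner_normal_prob.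
by apply/funext => x; rewrite hornerZ.
Qed.

Lemma gaussL0 s : gaussL s 0 = 0.
Proof.
by rewrite /gaussL /Rintegral integral0_eq// => x _; rewrite horner0.
Qed.

Lemma gaussL_sum s I (r : seq I) (P : pred I) (F : I -> {poly R}) : s != 0 ->
  gaussL s (\sum_(i <- r | P i) F i) = \sum_(i <- r | P i) gaussL s (F i).
Proof.
move=> s0; apply: (big_morph (gaussL s)); last exact: gaussL0.
by move=> p q; exact: gaussLD.
Qed.

Lemma gaussL1 s : gaussL s 1 = 1.
Proof.
rewrite /gaussL (_ : horner 1 = cst 1); last by apply/funext => x; rewrite hornerC.
have h : normal_prob 0 s setT = 1%E := integral_normal_pdf 0 s.
by rewrite Rintegral_cst// mul1r -[RHS]/(fine 1%E); congr fine; exact: h.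
Qed.

Lemma gaussL_stein s p : s != 0 -> gaussL s (p * 'X) = s ^+ 2 * gaussL s p^`().
Proof.
move=> s0; rewrite -gaussLZ//; apply/eqP; rewrite eq_sym -subr_eq0.
rewrite -mulN1r -gaussLZ// scaleN1r -gaussLD// /gaussL Rintegral_normal_prob.
  exact/eqP/integral_derive_poly_normal_pdf.
exact: measurable_horner.
Qed.

(** Monic Hermite polynomials of variance [s^2]. The operator iterated here is the adjoint, under
    the normal law, of [s^2] times differentiation. *)
Fixpoint hermite s (k : nat) : {poly R} :=
  if k is k'.+1 then hermite s k' * 'X - s ^+ 2 *: (hermite s k')^`() else 1.

Lemma deriv_hermite s k : (hermite s k.+1)^`() = k.+1%:R *: hermite s k.
Proof.
elim: k => [|k IH].
  have d1 : (1 : {poly R})^`() = 0 by exact: derivC.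
  by rewrite /= d1 scaler0 subr0 mul1r derivX scale1r.
rewrite -[hermite s k.+2]/(hermite s k.+1 * 'X - s ^+ 2 *: (hermite s k.+1)^`()).
rewrite derivB derivM derivX derivZ IH mulr1 derivZ.
rewrite [in RHS](_ : k.+2 = 1 + k.+1)%N// natrD scalerDl scale1r addrAC addrC; congr (_ + _).
have E : hermite s k.+1 = hermite s k * 'X - s ^+ 2 *: (hermite s k)^`() by [].
by rewrite E scalerBr -scalerAl !scalerA [s ^+ 2 * _]mulrC.
Qed.

Lemma derivn_hermite s k : (hermite s k)^`(k) = (k`!)%:R%:P.
Proof.
elim: k => [|k IH]; first by rewrite derivn0.
rewrite derivSn deriv_hermite derivnZ IH -mul_polyC -polyCM -natrM.
by rewrite factS.
Qed.

Lemma derivn_hermite_lt s j k : (j < k)%N -> (hermite s j)^`(k) = 0.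
Proof.
move=> jk; rewrite -(subnKC jk) addSn -addnS addnC -[LHS]/(iter _ _ _) iterD.
have E : iter j (@deriv R) (hermite s j) = (j`!)%:R%:P := derivn_hermite s j.
rewrite E iterSr derivC.
by elim: (k - j.+1)%N => //= m ->; rewrite deriv0.
Qed.

(** Integration by parts, [k] times: Stein's identity produces two derivatives, and the Hermite
    recursion cancels the one that falls on the Hermite factor. *)
Lemma gaussL_hermite s k p : s != 0 ->
  gaussL s (hermite s k * p) = s ^+ (2 * k) * gaussL s p^`(k).
Proof.
move=> s0; elim: k p => [|k IH] p; first by rewrite mul1r muln0 expr0 mul1r.
rewrite derivSn /= mulrBl mulrAC -scalerAl -scaleNr gaussLD// gaussLZ// gaussL_stein//.
rewrite derivM gaussLD// mulrDr mulNr addrAC subrr add0r IH.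
by rewrite mulrA -exprD mulnS.
Qed.

Lemma gaussL_hermite_hermite s j k : s != 0 ->
  gaussL s (hermite s j * hermite s k) = if j == k then s ^+ (2 * k) * (k`!)%:R else 0.
Proof.
move=> s0; have [jk|kj|->] := ltngtP j k.
- by rewrite mulrC gaussL_hermite// derivn_hermite_lt// gaussL0 mulr0.
- by rewrite gaussL_hermite// derivn_hermite_lt// gaussL0 mulr0.
- by rewrite gaussL_hermite// derivn_hermite -[_%:P]mulr1 mul_polyC gaussLZ// gaussL1 mulr1.
Qed.

(* The heat semigroup applied to 'X^a *)
Definition appell s a : {poly R} :=
  \sum_(i < a.+1) ('C(a, i)%:R * gaussL s 'X^(a - i)) *: 'X^i.

Lemma size_appell s a : (size (appell s a) <= a.+1)%N.
Proof.
apply: (leq_trans (size_sum _ _ _)); apply/bigmax_leqP => i _.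
by rewrite (leq_trans (size_scale_leq _ _))// size_polyXn ltnS -ltnS.
Qed.

Lemma gaussL_translate s a (x : R) : s != 0 ->
  gaussL s (('X + x%:P) ^+ a) = (appell s a).[x].
Proof.
move=> s0; rewrite exprDn gaussL_sum// /appell horner_sum; apply: eq_bigr => i _.
rewrite -polyC_exp mulrC mul_polyC scalerMnl gaussLZ//.
rewrite hornerZ hornerXn -[_ *+ _]mulr_natr; ring.
Qed.

Lemma deriv_appell s a : (appell s a.+1)^`() = a.+1%:R *: appell s a.
Proof.
rewrite /appell raddf_sum big_ord_recl /= expr0 derivZ derivC scaler0 add0r scaler_sumr.
apply: eq_bigr => i _; rewrite derivZ derivXn /bump leq0n add1n subSS /=.
rewrite -scalerMnr scalerMnl scalerA; congr (_ *: _).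
by rewrite mulrA -natrM mul_bin_diag natrM -mulr_natl mulrA.
Qed.

Lemma derivn_appell s a k : (appell s a)^`(k) = (a ^_ k)%:R *: appell s (a - k).
Proof.
elim: k a => [|k IH] a; first by rewrite derivn0 ffactn0 scale1r subn0.
case: a => [|a].
  by rewrite /appell big_ord1 expr0 derivSn derivZ derivC scaler0 linear0 ?ffact0n ?scale0r.
by rewrite derivSn deriv_appell derivnZ IH scalerA ffactnS -natrM subSS.
Qed.

Lemma derivn_translate a k (x : R) :
  (('X + x%:P) ^+ a)^`(k) = (a ^_ k)%:R *: ('X + x%:P) ^+ (a - k).
Proof.
elim: k a => [|k IH] a; first by rewrite derivn0 ffactn0 scale1r subn0.
case: a => [|a].
  by rewrite expr0 derivSn derivC ?ffact0n ?scale0r linear0.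
rewrite derivSn deriv_exp derivD derivX derivC addr0 mul1r /= -scaler_nat derivnZ IH scalerA.
by rewrite ffactnS -natrM subSS.
Qed.

(** Differentiating a translate in the noise or in [x] is the same, so the Hermite coefficients of
    the translated monomial are divided derivatives of its noise average. *)
Lemma gaussL_hermite_translate s k a (x : R) : s != 0 ->
  gaussL s (hermite s k * ('X + x%:P) ^+ a) =
  s ^+ (2 * k) * (k`!)%:R * ((appell s a)^`N(k)).[x].
Proof.
move=> s0; rewrite gaussL_hermite// derivn_translate gaussLZ// gaussL_translate//.
rewrite -mulrA; congr (_ * _); rewrite -hornerZ -derivn_appell nderivn_def.
by rewrite hornerMn -mulr_natl.
Qed.

End GaussianFunctional.

(** * The noise expectation on sums of products of univariate polynomials *)

Section GaussianExpectation.
Variables (R : realType) (n : nat).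
Implicit Types (F G : (pairT n -> R) -> R) (w : pairT n -> R).

Lemma sdev_neq0 (p : pairT n) : sdev R p != 0.
Proof. by rewrite /sdev; case: ifP => _; rewrite ?oner_neq0// gt_eqF// sqrtr_gt0. Qed.

Lemma sqr_sdev_ge1 (p : pairT n) : 1 <= sdev R p ^+ 2.
Proof. by rewrite /sdev; case: ifP => _; rewrite ?expr1n// sqr_sqrtr// ler1n. Qed.

(** A normal form for polynomials in the noise that each single integration preserves, so that no
    Fubini theorem is called for. *)
Definition prodsum (t : seq (R * (pairT n -> {poly R}))) w : R :=
  \sum_(x <- t) x.1 * \prod_p (x.2 p).[w p].

(** After the inner integrations the integrand is a polynomial in the current variable; [uniq] keeps
    an inner integral from overwriting that variable. *)
Lemma gauss_iter_prodsum s t w : uniq s ->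
  gauss_iter s (prodsum t) w = \sum_(x <- t) x.1 *
    \prod_p (if p \in s then gaussL (sdev R p) (x.2 p) else (x.2 p).[w p]).
Proof.
elim: s w => [|p0 s IH] w //= /andP[p0s us].
rewrite (_ : (fun y => _) = horner (\sum_(x <- t) (x.1 * \prod_(p | p != p0)
    (if p \in s then gaussL (sdev R p) (x.2 p) else (x.2 p).[w p])) *: x.2 p0)).
  rewrite -/(gaussL _ _) gaussL_sum ?sdev_neq0//; apply: eq_bigr => x _.
  rewrite gaussLZ ?sdev_neq0// [in RHS](bigD1 p0)//= mem_head mulrAC -mulrA.
  congr (_ * (_ * _)); apply: eq_bigr => p /negbTE pp0.
  by rewrite in_cons pp0.
apply/funext => y; rewrite IH// horner_sum; apply: eq_bigr => x _.
rewrite hornerZ (bigD1 p0)//= (negbTE p0s) eqxx mulrAC -mulrA.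
congr (_ * (_ * _)); apply: eq_bigr => p /negbTE pp0.
by rewrite pp0.
Qed.

Lemma EW_prodsum t :
  EW (prodsum t) = \sum_(x <- t) x.1 * \prod_p gaussL (sdev R p) (x.2 p).
Proof.
rewrite /EW gauss_iter_prodsum ?enum_uniq//; apply: eq_bigr => x _.
by congr (_ * _); apply: eq_bigr => p _; rewrite mem_enum.
Qed.

Lemma EW_ge0 F : (forall w, 0 <= F w) -> 0 <= EW F.
Proof.
move=> F0; rewrite /EW; elim: (enum _) (fun=> 0) => [|p s IH] w //=.
by apply: Rintegral_ge0 => y _; exact: IH.
Qed.

Definition polyfun F := exists t, F = prodsum t.

Lemma polyfun_prod (f : pairT n -> {poly R}) :
  polyfun (fun w => \prod_p (f p).[w p]).
Proof.
exists [:: (1, f)]; apply/funext => w.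
by rewrite /prodsum big_seq1 mul1r.
Qed.

Lemma EW_prod (f : pairT n -> {poly R}) :
  EW (fun w => \prod_p (f p).[w p]) = \prod_p gaussL (sdev R p) (f p).
Proof.
rewrite (_ : (fun w => _) = prodsum [:: (1, f)]); last first.
  by apply/funext => w; rewrite /prodsum big_seq1 mul1r.
by rewrite EW_prodsum big_seq1 mul1r.
Qed.

Lemma polyfunD F G : polyfun F -> polyfun G -> polyfun (fun w => F w + G w).
Proof.
move=> [t ->] [u ->]; exists (t ++ u); apply/funext => w.
by rewrite /prodsum big_cat.
Qed.

Lemma EWD F G : polyfun F -> polyfun G ->
  EW (fun w => F w + G w) = EW F + EW G.
Proof.
move=> [t ->] [u ->]; rewrite (_ : (fun w => _) = prodsum (t ++ u)).
  by rewrite !EW_prodsum big_cat.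
by apply/funext => w; rewrite /prodsum big_cat.
Qed.

Lemma polyfunZ (c : R) F : polyfun F -> polyfun (fun w => c * F w).
Proof.
move=> [t ->]; exists [seq (c * x.1, x.2) | x <- t]; apply/funext => w.
by rewrite /prodsum big_map mulr_sumr; apply: eq_bigr => x _; rewrite mulrA.
Qed.

Lemma EWZ (c : R) F : polyfun F -> EW (fun w => c * F w) = c * EW F.
Proof.
move=> [t ->]; rewrite (_ : (fun w => _) = prodsum [seq (c * x.1, x.2) | x <- t]).
  by rewrite !EW_prodsum big_map mulr_sumr; apply: eq_bigr => x _; rewrite mulrA.
by apply/funext => w; rewrite /prodsum big_map mulr_sumr; apply: eq_bigr => x _; rewrite mulrA.
Qed.

Lemma polyfunM F G : polyfun F -> polyfun G -> polyfun (fun w => F w * G w).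
Proof.
move=> [t ->] [u ->].
exists [seq (x.1 * y.1, fun p => x.2 p * y.2 p) | x <- t, y <- u].
apply/funext => w; rewrite /prodsum big_allpairs_dep/= mulr_suml; apply: eq_bigr => x _.
rewrite mulr_sumr; apply: eq_bigr => y _ /=; rewrite mulrACA -big_split/=.
by congr (_ * _); apply: eq_bigr => p _; rewrite hornerM.
Qed.

Lemma polyfun_sum I (r : seq I) (P : pred I) (F : I -> (pairT n -> R) -> R) :
  (forall i, P i -> polyfun (F i)) -> polyfun (fun w => \sum_(i <- r | P i) F i w).
Proof.
move=> PF; elim: r => [|i r IH].
  by exists [::]; apply/funext => w; rewrite /prodsum !big_nil.
have [Pi|/negbTE Pi] := boolP (P i); last first.
  by under eq_fun do rewrite big_cons Pi.
by under eq_fun do rewrite big_cons Pi; apply: polyfunD => //; exact: PF.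
Qed.

Lemma EW_sum I (r : seq I) (P : pred I) (F : I -> (pairT n -> R) -> R) :
  (forall i, P i -> polyfun (F i)) ->
  EW (fun w => \sum_(i <- r | P i) F i w) = \sum_(i <- r | P i) EW (F i).
Proof.
move=> PF; elim: r => [|i r IH].
  rewrite big_nil (_ : (fun w => _) = prodsum [::]).
    by rewrite EW_prodsum big_nil.
  by apply/funext => w; rewrite /prodsum !big_nil.
rewrite big_cons; have [Pi|/negbTE Pi] := boolP (P i); last first.
  by under eq_fun do rewrite big_cons Pi; exact: IH.
under eq_fun do rewrite big_cons Pi.
by rewrite EWD ?IH//; [exact: PF|exact: polyfun_sum].
Qed.

End GaussianExpectation.

(** * The recursion for kappa *)

Section Vertices.
Variable n : nat.
Implicit Types (a b : {ffun pairT n -> nat}) (p : pairT n) (i j : 'I_n).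

Definition incident i p := (i == (val p).1) || (i == (val p).2).

(** The root is left out: E[X^a] depends on the bare vertex set, E[v_1 X^a] on the set with the root
    added. *)
Definition verts a : {set 'I_n} := [set i | [exists p, (0 < a p)%N && incident i p]].

Lemma vertsP a i : reflect (exists2 p, (0 < a p)%N & incident i p) (i \in verts a).
Proof.
rewrite inE; apply: (iffP existsP) => [[p /andP[]]|[p]]; first by exists p.
by move=> ap ip; exists p; rewrite ap.
Qed.

Lemma val_pidx i j : val (pidx i j) = if (i <= j)%N then (i, j) else (j, i).
Proof. by []. Qed.

Lemma pidx_val p : pidx (val p).1 (val p).2 = p.
Proof. by apply: val_inj; rewrite val_pidx (valP p); case: (val p). Qed.

Lemma pidxC i j : pidx i j = pidx j i.
Proof.
apply: val_inj; rewrite !val_pidx; case: ltngtP => // /val_inj ->; by [].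
Qed.

Lemma incident_pidx k i j : incident k (pidx i j) = (k == i) || (k == j).
Proof. by rewrite /incident val_pidx; case: ifP => //= _; rewrite orbC. Qed.

Lemma pidx_incident i p : incident i p ->
  p = pidx i (if i == (val p).1 then (val p).2 else (val p).1).
Proof.
rewrite /incident; case: eqP => [->|_ /= /eqP ->]; first by rewrite pidx_val.
by rewrite pidxC pidx_val.
Qed.

Lemma verts0 a : (forall p, a p = 0%N) -> verts a = finset.set0.
Proof. by move=> a0; apply/setP => i; rewrite [RHS]inE; apply/negbTE/negP => /vertsP[p]; rewrite a0. Qed.

Lemma vertsD a b (c : {ffun pairT n -> nat}) : (forall p, c p = (a p + b p)%N) -> verts c = (verts a :|: verts b)%SET.
Proof.
move=> cE; apply/setP => i; rewrite finset.in_setU; apply/vertsP/orP => [[p]|[]/vertsP[p h1 h2]].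
- rewrite cE addn_gt0 => /orP[h|h] ip; [left|right]; by apply/vertsP; exists p.
- by exists p; rewrite // cE addn_gt0 h1.
- by exists p; rewrite // cE addn_gt0 h1 orbT.
Qed.

Lemma msizeD a b (c : {ffun pairT n -> nat}) : (forall p, c p = (a p + b p)%N) -> msize c = (msize a + msize b)%N.
Proof. by move=> cE; rewrite /msize -big_split; apply: eq_bigr => p _; rewrite cE. Qed.

Lemma leq_msize a p : (a p <= msize a)%N.
Proof. by rewrite /msize (bigD1 p)//= leq_addr. Qed.

Lemma msize_lt a b : (forall p, b p <= a p)%N -> b != a -> (msize b < msize a)%N.
Proof.
move=> ba nab; rewrite ltn_neqAle leq_sum ?andbT//.
apply: contraNneq nab => E; apply/eqP/ffunP => p; apply/eqP; rewrite eqn_leq ba/=.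
have : (\sum_(q | q != p) b q <= \sum_(q | q != p) a q)%N by exact: leq_sum.
by move: E; rewrite /msize (bigD1 p)//= [in RHS](bigD1 p)//= => E; lia.
Qed.

Lemma ffsubK a b : (forall p, b p <= a p)%N -> forall p, a p = (b p + ffsub a b p)%N.
Proof. by move=> ba p; rewrite ffunE subnKC. Qed.

Lemma ffnat_le k (b : {ffun pairT n -> 'I_k.+1}) p : (ffnat b p <= k)%N.
Proof. by rewrite ffunE -ltnS. Qed.

Lemma ffnat_inj k : injective (@ffnat n k).
Proof.
move=> b c /ffunP E; apply/ffunP => p; apply: val_inj.
by have := E p; rewrite !ffunE.
Qed.

Definition ffinord k a : {ffun pairT n -> 'I_k.+1} := [ffun p => inord (a p)].

Lemma ffinordK k a : (forall p, a p <= k)%N -> ffnat (ffinord k a) = a.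
Proof. by move=> ak; apply/ffunP => p; rewrite !ffunE inordK ?ltnS. Qed.

Lemma ffnatK k (b : {ffun pairT n -> 'I_k.+1}) : ffinord k (ffnat b) = b.
Proof. by apply/ffunP => p; rewrite !ffunE inord_val. Qed.

(** The recursion bounds its entries by [msize a], other sums by a common [D] or [K]; this moves
    between the ranges. *)
Lemma sum_ffnat_widen (V : nmodType) (N M : nat) (P : pred {ffun pairT n -> nat})
    (F : {ffun pairT n -> nat} -> V) :
  (forall a, P a -> forall p, (a p <= N)%N) -> (N <= M)%N ->
  \sum_(b : {ffun pairT n -> 'I_N.+1} | P (ffnat b)) F (ffnat b) =
  \sum_(b : {ffun pairT n -> 'I_M.+1} | P (ffnat b)) F (ffnat b).
Proof.
move=> PN NM.
pose h (b : {ffun pairT n -> 'I_N.+1}) : {ffun pairT n -> 'I_M.+1} := ffinord M (ffnat b).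
pose h' (b : {ffun pairT n -> 'I_M.+1}) : {ffun pairT n -> 'I_N.+1} := ffinord N (ffnat b).
rewrite [RHS](reindex_onto h h') /h /h'; last first.
  by move=> b Pb /=; rewrite ffinordK ?ffnatK//; exact: PN.
have K (b : {ffun pairT n -> 'I_N.+1}) : ffnat (ffinord M (ffnat b)) = ffnat b.
  by rewrite ffinordK// => p; rewrite (leq_trans (ffnat_le _ _)).
by apply: eq_big => [b|b _]; rewrite K// ffnatK eqxx andbT.
Qed.

Lemma sum_mbinom a K : (forall p, a p <= K)%N ->
  (\sum_(b : {ffun pairT n -> 'I_K.+1}) mbinom a (ffnat b) = 2 ^ msize a)%N.
Proof.
move=> aK; under eq_bigr do rewrite /mbinom.
transitivity (\prod_(p : pairT n) \sum_(j < K.+1) 'C(a p, j))%N.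
  rewrite bigA_distr_bigA; apply: eq_bigr => b _; apply: eq_bigr => p _.
  by rewrite ffunE.
rewrite /msize expn_sum; apply: eq_bigr => p _.
rewrite -[RHS]/((1 + 1) ^ a p)%N expnDn.
transitivity (\sum_(0 <= j < K.+1) 'C(a p, j))%N; first by rewrite big_mkord.
rewrite (@big_cat_nat _ _ _ (a p).+1) ?ltnS ?aK//=.
have -> : (\sum_((a p).+1 <= j < K.+1) 'C(a p, j) = 0)%N.
  by rewrite big_nat big1// => j /andP[j1 _]; rewrite bin_small.
by rewrite addn0 big_mkord; apply: eq_bigr => j _; rewrite !exp1n !muln1.
Qed.

End Vertices.

(** * Moments of the planted vector *)

Section Expectations.
Variables (R : realType) (n : nat) (rho lam : R).
Implicit Types (a b : {ffun pairT n -> nat}) (v : {ffun 'I_n -> bool}).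

Definition onv v : {set 'I_n} := [set i | v i].

Lemma EvD (f g : {ffun 'I_n -> bool} -> R) :
  Ev rho (fun v => f v + g v) = Ev rho f + Ev rho g.
Proof. by rewrite /Ev -big_split; apply: eq_bigr => v _; rewrite mulrDr. Qed.

Lemma EvZ (c : R) (f : {ffun 'I_n -> bool} -> R) :
  Ev rho (fun v => c * f v) = c * Ev rho f.
Proof. by rewrite /Ev mulr_sumr; apply: eq_bigr => v _; rewrite mulrCA. Qed.

Lemma Ev_sum I (r : seq I) (P : pred I) (f : I -> {ffun 'I_n -> bool} -> R) :
  Ev rho (fun v => \sum_(i <- r | P i) f i v) = \sum_(i <- r | P i) Ev rho (f i).
Proof. by rewrite /Ev exchange_big/=; apply: eq_bigr => v _; rewrite mulr_sumr. Qed.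

Lemma eq_Ev (f g : {ffun 'I_n -> bool} -> R) : f =1 g -> Ev rho f = Ev rho g.
Proof. by move=> fg; congr Ev; apply/funext. Qed.

Lemma Ev_ge0 (f : {ffun 'I_n -> bool} -> R) : 0 <= rho <= 1 ->
  (forall v, 0 <= f v) -> 0 <= Ev rho f.
Proof.
move=> /andP[r0 r1] f0; apply: sumr_ge0 => v _; rewrite mulr_ge0// prodr_ge0// => i _.
by case: ifP => _; rewrite ?subr_ge0.
Qed.

Lemma Ev_onv (S : {set 'I_n}) : Ev rho (fun v => (S \subset onv v)%:R) = rho ^+ #|S|.
Proof.
transitivity (\prod_(i < n) \sum_(b : bool)
    (if b then rho else 1 - rho) * (if i \in S then b%:R else 1)).
  rewrite bigA_distr_bigA; apply: eq_bigr => v _; rewrite big_split/=; congr (_ * _).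
  rewrite -big_mkcond/=; have [/fintype.subsetP Sv|] := boolP (S \subset onv v).
    by rewrite big1// => i /Sv; rewrite inE => ->.
  case/subsetPn => i iS; rewrite inE => /negbTE vi.
  by rewrite (bigD1 i)//= vi mul0r.
rewrite -prodr_const [RHS]big_mkcond/=; apply: eq_bigr => i _.
by rewrite big_bool; case: ifP => _ /=; rewrite ?mulr0n ?mulr1n; ring.
Qed.

Lemma Ev1 : Ev (n := n) rho (fun=> 1) = 1.
Proof.
transitivity (Ev rho (fun v => ((finset.set0 : {set 'I_n}) \subset onv v)%:R)).
  by apply: eq_Ev => v; rewrite finset.sub0set.
by rewrite Ev_onv finset.cards0 expr0.
Qed.

(** Memberships are 0 or 1, so beyond the power of [lam] an exponent matters only through the
    vertices it touches. *)
Lemma XpowE v a : Xpow lam v a = lam ^+ msize a * (verts a \subset onv v)%:R.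
Proof.
rewrite /Xpow; under eq_bigr do rewrite -mulrA exprMn.
rewrite big_split/= prodrXr -/(msize a); congr (_ * _).
have [/fintype.subsetP Sv|] := boolP (verts a \subset onv v).
  rewrite big1// => p _; have [/eqP->|ap] := boolP (a p == 0%N); first by rewrite expr0.
  have h i : incident i p -> v i.
    move=> ip; suff : i \in onv v by rewrite inE.
    by apply: Sv; apply/vertsP; exists p; rewrite // lt0n.
  by rewrite !h /incident ?eqxx ?orbT// mul1r expr1n.
case/subsetPn => i /vertsP[p ap ip]; rewrite inE => /negbTE vi.
rewrite (bigD1 p)//= (_ : _ ^+ a p = 0) ?mul0r//.
apply/eqP; rewrite expf_eq0 ap/=; case/orP: ip => /eqP <-; rewrite vi ?mul0r ?mulr0//.
Qed.

Lemma Ev_Xpow a : Ev rho (fun v => Xpow lam v a) = lam ^+ msize a * rho ^+ #|verts a|.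
Proof. by under eq_Ev do rewrite XpowE; rewrite EvZ Ev_onv. Qed.

Lemma Ev_vXpow i0 a : Ev rho (fun v => (v i0)%:R * Xpow lam v a) =
  lam ^+ msize a * rho ^+ #|(i0 |: verts a)%SET|.
Proof.
rewrite -Ev_onv -EvZ; apply: eq_Ev => v; rewrite XpowE mulrCA; congr (_ * _).
by rewrite finset.subUset finset.sub1set inE -natrM mulnb.
Qed.

End Expectations.

Section KappaRecursion.
Variables (R : realType) (n : nat) (rho lam : R) (i0 : 'I_n).
Implicit Types (a b : {ffun pairT n -> nat}).
Local Notation kap := (kappa rho lam i0).

Definition lef b a := [forall p, (b p <= a p)%N].

Lemma lefP b a : reflect (forall p, (b p <= a p)%N) (lef b a).
Proof. exact: forallP. Qed.

Lemma lef_ffnat k (b : {ffun pairT n -> 'I_k}) a :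
  [forall p, (b p <= a p)%N] = lef (ffnat b) a.
Proof. by apply: eq_forallb => p; rewrite ffunE. Qed.

Lemma kappa_fuel_eq k1 k2 a : (msize a < k1)%N -> (msize a < k2)%N ->
  kappa_fuel rho lam i0 k1 a = kappa_fuel rho lam i0 k2 a.
Proof.
elim: k1 k2 a => [|k1 IH] [|k2] a //= h1 h2; congr (_ - _).
apply: eq_bigr => b /andP[]; rewrite lef_ffnat => /lefP ba nab; congr (_ * _ * _).
have lt := msize_lt ba nab.
by apply: IH; [exact: leq_trans lt _ | exact: leq_trans lt _].
Qed.

Lemma kappaE a : kap a = Ev rho (fun v => (v i0)%:R * Xpow lam v a)
  - \sum_(b : {ffun pairT n -> 'I_(msize a).+1} | lef (ffnat b) a && (ffnat b != a))
      kap (ffnat b) * (mbinom a (ffnat b))%:R * Ev rho (fun v => Xpow lam v (ffsub a (ffnat b))).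
Proof.
rewrite {1}/kappa [LHS]/=; congr (_ - _); apply: eq_big => b; first by rewrite lef_ffnat.
rewrite lef_ffnat => /andP[/lefP ba nab]; congr (_ * _ * _).
by apply: kappa_fuel_eq => //; exact: msize_lt.
Qed.

Lemma kappa_term_self a :
  kap a * (mbinom a a)%:R * Ev rho (fun v => Xpow lam v (ffsub a a)) = kap a.
Proof.
have -> : (mbinom a a)%:R = 1 :> R by rewrite /mbinom big1// => p _; rewrite binn.
have a0 p : ffsub a a p = 0%N by rewrite ffunE subnn.
have vz : verts (ffsub a a) = finset.set0 by exact: verts0.
have mz : msize (ffsub a a) = 0%N by rewrite /msize big1.
by rewrite mulr1 Ev_Xpow vz mz finset.cards0 !expr0 !mulr1.
Qed.

(** The recursion with the subtracted terms moved across, [b = a] giving kappa itself. The free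
    bound [K] lets several multi-indices share one range. *)
Lemma kappa_rec K a : (forall p, a p <= K)%N ->
  Ev rho (fun v => (v i0)%:R * Xpow lam v a) =
  \sum_(b : {ffun pairT n -> 'I_K.+1} | lef (ffnat b) a)
    kap (ffnat b) * (mbinom a (ffnat b))%:R * Ev rho (fun v => Xpow lam v (ffsub a (ffnat b))).
Proof.
move=> aK; pose F b := kap b * (mbinom a b)%:R * Ev rho (fun v => Xpow lam v (ffsub a b)).
have aM p : (a p <= msize a)%N := leq_msize a p.
transitivity (\sum_(b : {ffun pairT n -> 'I_(msize a).+1} | lef (ffnat b) a) F (ffnat b)).
  rewrite (bigD1 (ffinord (msize a) a)) /=; last by rewrite ffinordK//; exact/lefP.
  rewrite [X in F X]ffinordK// {1}/F kappa_term_self kappaE.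
  rewrite -addrA [X in _ + X](_ : _ = 0) ?addr0//.
  apply/eqP; rewrite addrC subr_eq0; apply/eqP; apply: eq_bigl => b; congr andb.
  apply/idP/idP; apply: contraNN => /eqP.
    by move=> ba; apply/eqP/ffnat_inj; rewrite ba ffinordK.
  by move=> ->; rewrite ffinordK.
have aP b : lef b a -> forall p, (b p <= a p)%N by move/lefP.
have [l|l] := leqP (msize a) K.
  by apply: (@sum_ffnat_widen _ _ (msize a) K (fun b => lef b a) F) => // b /aP h p; exact: leq_trans (h p) _.
apply/esym/(@sum_ffnat_widen _ _ K (msize a) (fun b => lef b a) F); last exact: ltnW.
by move=> b /aP h p; exact: leq_trans (h p) _.
Qed.

End KappaRecursion.

(** * Connection of a multigraph to the root *)

Section Connectedness.
Variables (n : nat) (i0 : 'I_n).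
Implicit Types (a b : {ffun pairT n -> nat}).

Definition adj a : rel 'I_n := fun i j => (0 < a (pidx i j))%N.

Definition comp a : {set 'I_n} := [set j | connect (adj a) i0 j].

(** Only vertices that carry an edge are tested, so the zero index is connected. *)
Definition conn a := verts a \subset comp a.

Definition edge_closed a (S : {set 'I_n}) :=
  forall p i j, (0 < a p)%N -> incident i p -> incident j p -> (i \in S) = (j \in S).

Lemma comp_sub a (S : {set 'I_n}) : i0 \in S -> edge_closed a S -> comp a \subset S.
Proof.
move=> iS cS; apply/fintype.subsetP => j; rewrite inE => ij.
have cl : fingraph.closed (adj a) (mem S).
  by move=> x y xy; apply: (cS (pidx x y)); rewrite ?incident_pidx ?eqxx ?orbT.
by rewrite -(closed_connect cl ij).
Qed.

Lemma comp0 a : i0 \in comp a.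
Proof. by rewrite inE connect0. Qed.

Lemma comp_closed a : edge_closed a (comp a).
Proof.
move=> p i j ap ip jp; rewrite !inE.
have sy : connect_sym (adj a).
  by apply: sym_connect_sym => x y; rewrite /adj pidxC.
have [->//|nij] := eqVneq i j.
apply: same_connect_r => //; apply: connect1; rewrite /adj.
suff <- : p = pidx i j by [].
rewrite {1}(pidx_incident ip); congr pidx; move: ip jp nij; rewrite /incident.
case: (val p) => x y /=.
by do 2!case/orP => /eqP ->; rewrite ?eqxx//; case: eqP.
Qed.

Lemma edge_closedS a b S : (forall p, b p <= a p)%N -> edge_closed a S -> edge_closed b S.
Proof. by move=> ba cS p i j bp; apply: cS; exact: leq_trans bp (ba p). Qed.

(* The gain of one vertex here is what makes every subtracted term of the
   recursion for [kappa] smaller than the leading one by a factor [rho]. *)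
Lemma conn_overlap a b (c : {ffun pairT n -> nat}) : (forall p, a p = (b p + c p)%N) -> conn a -> b != a ->
  (#|i0 |: verts a| < #|i0 |: verts b| + #|verts c|)%N.
Proof.
move=> abc ca nab; have nab' : ~ (forall p, c p = 0%N).
  by move=> c0; move/eqP: nab; apply; apply/ffunP => p; rewrite abc c0 addn0.
rewrite -cardsUI (vertsD abc) finset.setUA -[X in (X < _)%N]addn0 ltn_add2l card_gt0.
apply/eqP => I0.
have dis i : i \in verts c -> i \notin (i0 |: verts b)%SET.
  move=> ic; apply/negP => ib; have : i \in ((i0 |: verts b) :&: verts c)%SET.
    by rewrite finset.in_setI ib.
  by rewrite I0 finset.in_set0.
(* Without a shared vertex, the root and the vertices of [b] would be closed under the edges of [a],
   hence contain every vertex of [a], and [c] would have no edge. *)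
have cl : edge_closed a (i0 |: verts b)%SET.
  move=> p i j; rewrite abc addn_gt0 => /orP[bp|cp] ip jp.
    have h k : incident k p -> k \in (i0 |: verts b)%SET.
      by move=> kp; rewrite finset.in_setU; apply/orP; right; apply/vertsP; exists p.
    by rewrite !h.
  have h k : incident k p -> k \in (i0 |: verts b)%SET = false.
    by move=> kp; apply/negbTE/dis/vertsP; exists p.
  by rewrite !h.
have sub := comp_sub (setU11 i0 (verts b)) cl.
apply: nab' => p; apply/eqP; rewrite -leqn0 leqNgt; apply/negP => cp.
have ic : (val p).1 \in verts c by apply/vertsP; exists p; rewrite // /incident eqxx.
have := dis _ ic; apply/negP; rewrite negbK; apply: (fintype.subsetP sub).
by apply: (fintype.subsetP ca); rewrite (vertsD abc) finset.in_setU ic orbT.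
Qed.

End Connectedness.

(** * Vanishing and size of kappa *)

Section KappaBounds.
Variables (R : realType) (n : nat) (rho lam : R) (i0 : 'I_n).
Implicit Types (a b : {ffun pairT n -> nat}).
Local Notation kap := (kappa rho lam i0).

(** Split [a = a1 + a2] with [a1] the part in the root's component; the two parts are independent.
    The terms [b <= a1] of the recursion then already sum to E[v_1 X^a1] E[X^a2] = E[v_1 X^a]. Every
    other [b] is disconnected, hence contributes 0 by induction unless it is [a], so kappa of [a] is
    0 too. *)
Lemma kappa_disconnected a : ~~ conn i0 a -> kap a = 0.
Proof.
have [m] := ubnP (msize a); elim: m a => // m IH a; rewrite ltnS => am.
case/subsetPn => i /vertsP[p0 ap0 ip0] iS; set S := comp i0 a in iS.
have cS : edge_closed a S := @comp_closed n i0 a.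
pose a1 : {ffun pairT n -> nat} := [ffun p => if (val p).1 \in S then a p else 0%N].
pose a2 : {ffun pairT n -> nat} := [ffun p => if (val p).1 \in S then 0%N else a p].
have aE p : a p = (a1 p + a2 p)%N by rewrite !ffunE; case: ifP; rewrite ?addn0.
have a1a p : (a1 p <= a p)%N by rewrite aE leq_addr.
have inc1 (p : pairT n) : incident (val p).1 p by rewrite /incident eqxx.
have V1 (c : {ffun pairT n -> nat}) : (forall p, c p <= a1 p)%N -> verts c \subset S.
  move=> ca; apply/fintype.subsetP => j /vertsP[p cp jp].
  have := leq_trans cp (ca p); rewrite ffunE; case: ifP => // pS ap.
  by rewrite (cS p j (val p).1).
have V2 j : j \in verts a2 -> j \notin S.
  move=> /vertsP[p]; rewrite ffunE; case: ifP => // pS ap jp.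
  by rewrite (cS p j (val p).1)// pS.
have V12 (c d : {ffun pairT n -> nat}) : (forall p, c p <= a1 p)%N ->
    (forall p, d p = (c p + a2 p)%N) -> #|verts d| = (#|verts c| + #|verts a2|)%N /\
    #|(i0 |: verts d)%SET| = (#|(i0 |: verts c)%SET| + #|verts a2|)%N.
  move=> ca dE; rewrite (vertsD dE) finset.setUA.
  have I0 (A : {set 'I_n}) : A \subset S -> #|(A :|: verts a2)%SET| = (#|A| + #|verts a2|)%N.
    move=> AS; rewrite finset.cardsU; apply/eqP; rewrite -[X in _ == X]subn0; apply/eqP; congr subn.
    apply/eqP; rewrite cards_eq0; apply/eqP/setP => j; rewrite finset.in_setI finset.in_set0.
    by apply/negbTE/negP => /andP[/(fintype.subsetP AS) jS /V2]; rewrite jS.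
  split; apply: I0; first exact: V1.
  by rewrite finset.subUset finset.sub1set comp0 V1.
pose K := msize a.
have aK p : (a p <= K)%N := leq_msize a p.
have Ra := kappa_rec rho lam i0 aK.
have Ra1 := kappa_rec rho lam i0 (fun p => leq_trans (a1a p) (aK p)).
pose E := Ev rho (fun v => Xpow lam v a2).
have Ea : Ev rho (fun v => (v i0)%:R * Xpow lam v a) =
    Ev rho (fun v => (v i0)%:R * Xpow lam v a1) * E.
  rewrite /E !Ev_vXpow Ev_Xpow (V12 _ _ (fun=> leqnn _) aE).2 (msizeD aE) !exprD.
  by rewrite mulrACA.
have T1 b : lef b a1 -> (mbinom a b)%:R * Ev rho (fun v => Xpow lam v (ffsub a b)) =
   (mbinom a1 b)%:R * Ev rho (fun v => Xpow lam v (ffsub a1 b)) * E.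
  move=> /lefP ba; rewrite -mulrA; congr (_ * _).
    congr (_%:R); apply: eq_bigr => p _; have := ba p; rewrite ffunE.
    by case: ifP => // _; rewrite leqn0 => /eqP ->; rewrite !bin0.
  have dE p : ffsub a b p = (ffsub a1 b p + a2 p)%N.
    by have := ba p; rewrite !(ffunE (fun p => (_ - _)%N)) aE => ?; lia.
  have ca p : (ffsub a1 b p <= a1 p)%N by rewrite ffunE leq_subr.
  by rewrite /E !Ev_Xpow (V12 _ _ ca dE).1 (msizeD dE) !exprD mulrACA.
move: Ra; rewrite (bigID (fun b : {ffun pairT n -> 'I_K.+1} => lef (ffnat b) a1))/=.
rewrite (eq_bigl (fun b : {ffun pairT n -> 'I_K.+1} => lef (ffnat b) a1)); last first.
  move=> b; apply/andP/idP => [[]//|h]; split=> //; apply/lefP => p.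
  by apply: leq_trans (a1a p); move/lefP: h.
under eq_bigr => b ba do rewrite -mulrA T1// 2!mulrA.
rewrite -mulr_suml -Ra1 -Ea (bigD1 (ffinord K a)) /=; last first.
  rewrite ffinordK//; apply/andP; split; first exact/lefP.
  have a10 : a1 p0 = 0%N.
    by rewrite ffunE -(cS p0 i (val p0).1 ap0 ip0 (inc1 p0)) (negbTE iS).
  by apply/lefP => /(_ p0); rewrite a10 leqn0 => /eqP ap1; rewrite ap1 in ap0.
rewrite ffinordK// kappa_term_self big1 ?addr0.
  by move/eqP; rewrite -[X in X == _]addr0 (inj_eq (addrI _)) eq_sym => /eqP.
move=> b /andP[/andP[/lefP ba nba1] nab].
have nab' : ffnat b != a by apply: contraNneq nab => <-; rewrite ffnatK.
rewrite IH ?mul0r//; first exact: leq_trans (msize_lt ba nab') am.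
(* Some pair [q] used by [b] lies outside the component of the root in [a], which contains that of
   the smaller index [b]. *)
move: nba1 => /forallPn[q]; rewrite -ltnNge [X in (X < _)%N]ffunE.
have := ba q; case: ifP => [_ h|qS h bq]; first by rewrite ltnNge h.
apply/subsetPn; exists (val q).1; first by apply/vertsP; exists q.
apply: contraFN qS; apply: (fintype.subsetP (comp_sub (comp0 _ _) _)).
exact: edge_closedS cS.
Qed.

(** Strong induction needs both outer bounds: nonnegative smaller kappas make the subtracted sum [T]
    nonnegative, their upper bounds make it at most half of the leading term [L]. These bounds cover
    disconnected [b] as well, so [T] is not split. *)
Lemma kappa_bounds a : 0 < rho < 1 -> 0 <= lam -> 2 ^+ (msize a).+1 * rho <= 1 ->
  0 <= kap a <= lam ^+ msize a * rho ^+ #|(i0 |: verts a)%SET| /\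
  (conn i0 a -> lam ^+ msize a * rho ^+ #|(i0 |: verts a)%SET| / 2 <= kap a).
Proof.
move=> /andP[r0 r1] l0; have [m] := ubnP (msize a).
elim: m a => // m IH a; rewrite ltnS => am ra.
set L := lam ^+ msize a * rho ^+ _.
have L0 : 0 <= L by rewrite mulr_ge0// exprn_ge0// ltW.
have [ca|nca] := boolP (conn i0 a); last by rewrite kappa_disconnected// lexx.
set T := \sum_(b : {ffun pairT n -> 'I_(msize a).+1} | lef (ffnat b) a && (ffnat b != a))
  kap (ffnat b) * (mbinom a (ffnat b))%:R * Ev rho (fun v => Xpow lam v (ffsub a (ffnat b))).
have kE : kap a = L - T by rewrite kappaE Ev_vXpow.
have T0 : 0 <= T.
  apply: sumr_ge0 => b /andP[/lefP ba nab]; have lt := msize_lt ba nab.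
  have rb : 2 ^+ (msize (ffnat b)).+1 * rho <= 1.
    apply: le_trans ra; rewrite ler_wpM2r ?(ltW r0)// ler_weXn2l ?ler1n ?ltnS ?(ltnW lt)//.
  have [/andP[kb _] _] := IH _ (leq_trans lt am) rb.
  by rewrite mulr_ge0 ?mulr_ge0// Ev_Xpow mulr_ge0// exprn_ge0// ltW.
have TL : T <= L / 2.
  (* The range is enlarged to all [b], so that the binomials total exactly [2 ^ msize a]. *)
  apply: (@le_trans _ _ (\sum_(b : {ffun pairT n -> 'I_(msize a).+1})
      (mbinom a (ffnat b))%:R * (L * rho))).
    rewrite [leRHS](bigID (fun b : {ffun pairT n -> 'I_(msize a).+1} => lef (ffnat b) a && (ffnat b != a)))/=.
    apply: ler_wpDr; first by apply: sumr_ge0 => b _; rewrite mulr_ge0 ?ler0n// mulr_ge0 ?(ltW r0).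
    apply: ler_sum => b /andP[/lefP ba nab]; have lt := msize_lt ba nab.
    have rb : 2 ^+ (msize (ffnat b)).+1 * rho <= 1.
      apply: le_trans ra; rewrite ler_wpM2r ?(ltW r0)// ler_weXn2l ?ler1n ?ltnS ?(ltnW lt)//.
    have [/andP[kb kb2] _] := IH _ (leq_trans lt am) rb.
    rewrite mulrAC mulrC ler_wpM2l// Ev_Xpow.
    apply: (@le_trans _ _ ((lam ^+ msize (ffnat b) * rho ^+ #|(i0 |: verts (ffnat b))%SET|) *
      (lam ^+ msize (ffsub a (ffnat b)) * rho ^+ #|verts (ffsub a (ffnat b))|))).
      by rewrite ler_wpM2r// mulr_ge0// exprn_ge0// ltW.
    have ov := conn_overlap (ffsubK ba) ca nab.
    rewrite mulrACA -!exprD -(msizeD (ffsubK ba)) /L -mulrA -exprSr ler_wpM2l ?exprn_ge0//.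
    by rewrite ler_wiXn2l// ltW.
  rewrite -mulr_suml -natr_sum sum_mbinom; last exact: leq_msize.
  rewrite natrX; move: ra; rewrite exprSr -mulrA => ra.
  by have := ler_wpM2l L0 ra; set x := 2 ^+ _; clearbody L x; clear; lra.
rewrite kE; clearbody L T; move: L0 T0 TL; clear => L0 T0 TL.
split; first by apply/andP; split; lra.
by move=> _; lra.
Qed.

End KappaBounds.

(** * The correlation bound *)

Section LowDegree.
Variables (R : realType) (n : nat) (rho lam : R) (i0 : 'I_n).
Local Notation kap := (kappa rho lam i0).
Implicit Types (v : {ffun 'I_n -> bool}) (w : pairT n -> R).

Definition signal v (p : pairT n) : R := lam * (v (val p).1)%:R * (v (val p).2)%:R.

Lemma horner_nderivn_wide (p : {poly R}) (k m : nat) (x : R) : (size p <= m)%N ->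
  (p^`N(k)).[x] = \sum_(j < m) p`_j * ('C(j, k)%:R * x ^+ (j - k)).
Proof.
move=> pm; rewrite -{1}(coefK p) (poly_def (size p)) linear_sum horner_sum.
rewrite (eq_bigr (fun j : 'I_(size p) => p`_j * ('C(j, k)%:R * x ^+ (j - k)))); last first.
  by move=> j _; rewrite linearZ/= nderivnXn hornerZ hornerMn hornerXn mulr_natl.
rewrite -!(big_mkord xpredT (fun j => p`_j * ('C(j, k)%:R * x ^+ (j - k)))).
rewrite [RHS](@big_cat_nat _ _ _ (size p))//= [X in _ + X]big_nat [X in _ + X]big1 ?addr0//.
by move=> j /andP[pj _]; rewrite nth_default ?mul0r.
Qed.

(** Linear extension of the recursion from monomials to products of polynomials, with binom(a, b)
    X^(a-b) read as a divided derivative of X^a. *)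
Lemma kappa_prod_poly (psi : pairT n -> {poly R}) (A : pairT n -> nat) (D : nat) :
  (forall p, size (psi p) <= (A p).+1)%N -> (\sum_p A p <= D)%N ->
  Ev rho (fun v => (v i0)%:R * \prod_p (psi p).[signal v p]) =
  \sum_(b : {ffun pairT n -> 'I_D.+1} | (msize (ffnat b) <= D)%N)
    kap (ffnat b) * Ev rho (fun v => \prod_p ((psi p)^`N(b p)).[signal v p]).
Proof.
move=> psiA AD.
have AD1 p : (A p <= D)%N by rewrite (leq_trans _ AD)// (bigD1 p)//= leq_addr.
have sD p : (size (psi p) <= D.+1)%N by rewrite (leq_trans (psiA p)) ?ltnS ?AD1.
pose co (c : {ffun pairT n -> 'I_D.+1}) := \prod_p (psi p)`_(c p).
have E1 v : \prod_p (psi p).[signal v p] =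
    \sum_(c : {ffun pairT n -> 'I_D.+1}) co c * Xpow lam v (ffnat c).
  under eq_bigr do rewrite (horner_coef_wide _ (sD _)).
  rewrite bigA_distr_bigA; apply: eq_bigr => c _; rewrite big_split; congr (_ * _).
  by apply: eq_bigr => p _; rewrite ffunE.
have E2 v (b : {ffun pairT n -> 'I_D.+1}) : \prod_p ((psi p)^`N(b p)).[signal v p] =
    \sum_(c : {ffun pairT n -> 'I_D.+1}) co c *
      ((mbinom (ffnat c) (ffnat b))%:R * Xpow lam v (ffsub (ffnat c) (ffnat b))).
  under eq_bigr do rewrite (horner_nderivn_wide _ _ (sD _)).
  rewrite bigA_distr_bigA; apply: eq_bigr => c _; rewrite !big_split/= natr_prod.
  by congr (_ * (_ * _)); apply: eq_bigr => p _; rewrite !ffunE.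
transitivity (\sum_(c : {ffun pairT n -> 'I_D.+1}) co c *
    Ev rho (fun v => (v i0)%:R * Xpow lam v (ffnat c))).
  under eq_Ev do rewrite E1 mulr_sumr; rewrite Ev_sum; apply: eq_bigr => c _.
  by rewrite -EvZ; apply: eq_Ev => v; rewrite mulrCA.
have E3 (b : {ffun pairT n -> 'I_D.+1}) :
    Ev rho (fun v => \prod_p ((psi p)^`N(b p)).[signal v p]) =
    \sum_(c : {ffun pairT n -> 'I_D.+1}) co c * ((mbinom (ffnat c) (ffnat b))%:R *
       Ev rho (fun v => Xpow lam v (ffsub (ffnat c) (ffnat b)))).
  under eq_Ev do rewrite E2; rewrite Ev_sum; apply: eq_bigr => c _.
  by rewrite -EvZ -EvZ.
under [RHS]eq_bigr do rewrite E3 mulr_sumr.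
rewrite exchange_big/=; apply: eq_bigr => c _.
(* The range admits multi-indices of total size above [D]; the degree bounds on [psi] give them
   coefficient 0. *)
have [->|c0] := eqVneq (co c) 0.
  by rewrite mul0r big1// => b _; rewrite mul0r mulr0.
have cA p : (c p <= A p)%N.
  rewrite leqNgt; apply/negP => Ac; move/eqP: c0; apply.
  by rewrite /co (bigD1 p)//= nth_default ?mul0r// (leq_trans (psiA p)).
have cD : (msize (ffnat c) <= D)%N.
  by rewrite (leq_trans _ AD)// leq_sum// => p _; rewrite ffunE.
rewrite (kappa_rec rho lam i0 (ffnat_le c)) mulr_sumr.
rewrite [RHS](bigID (fun b : {ffun pairT n -> 'I_D.+1} => lef (ffnat b) (ffnat c)))/=.
rewrite [X in _ = _ + X]big1 ?addr0; last first.
  move=> b /andP[_ /forallPn[p]]; rewrite -ltnNge => bp.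
  by rewrite /mbinom (bigD1 p)//= bin_small// mul0n mul0r !mulr0.
apply: eq_big => [b|b _]; last by rewrite -mulrA mulrCA.
apply/idP/andP => [bc|[]//]; split=> //; apply: leq_trans cD.
by apply: leq_sum => p _; move/lefP: bc.
Qed.

Section Polynomial.
Variables (D : nat) (c : {ffun 'I_n * 'I_n -> 'I_D.+1} -> R).

(** The polynomial has all [n^2] entries as variables, but [(i, j)] and [(j, i)] carry the same
    noise, so their exponents merge. *)
Definition pushexp (a : {ffun 'I_n * 'I_n -> 'I_D.+1}) (p : pairT n) : nat :=
  \sum_(q : 'I_n * 'I_n | pidx q.1 q.2 == p) a q.

Lemma sum_pushexp a : (\sum_p pushexp a p = \sum_q a q)%N.
Proof. by rewrite [RHS](partition_big (fun q => pidx q.1 q.2) xpredT). Qed.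

Lemma Yof_signal v w i j : Yof lam v w i j = signal v (pidx i j) + w (pidx i j).
Proof.
rewrite /Yof /signal val_pidx; congr (_ + _); case: ifP => //= _.
by rewrite mulrAC.
Qed.

Definition obs v w := polyD c (Yof lam v w).

Lemma obsE v w : obs v w =
  \sum_(a : {ffun 'I_n * 'I_n -> 'I_D.+1} | (\sum_q a q <= D)%N)
    c a * \prod_p (('X + (signal v p)%:P) ^+ pushexp a p).[w p].
Proof.
rewrite /obs /polyD; apply: eq_bigr => a _; congr (_ * _).
rewrite (partition_big (fun q : 'I_n * 'I_n => pidx q.1 q.2) xpredT)//=.
apply: eq_bigr => p _; rewrite horner_exp hornerD hornerX hornerC /pushexp -prodrXr.
by apply: eq_bigr => q /eqP <-; rewrite Yof_signal addrC.
Qed.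

Lemma polyfun_obs v : polyfun (obs v).
Proof.
rewrite (funext (obsE v)).
by apply: polyfun_sum => a _; apply/polyfunZ/polyfun_prod.
Qed.

Lemma EW_obs v : EW (obs v) =
  \sum_(a : {ffun 'I_n * 'I_n -> 'I_D.+1} | (\sum_q a q <= D)%N)
    c a * \prod_p (appell (sdev R p) (pushexp a p)).[signal v p].
Proof.
rewrite (funext (obsE v)).
rewrite EW_sum; last by move=> a _; apply/polyfunZ/polyfun_prod.
apply: eq_bigr => a _; rewrite EWZ ?EW_prod; last exact: polyfun_prod.
by congr (_ * _); apply: eq_bigr => p _; rewrite gaussL_translate ?sdev_neq0.
Qed.

(** Second moment of the product Hermite polynomial; only the diagonal pairs, of variance 2, make it
    differ from [b!]. *)
Definition herm_norm (b : {ffun pairT n -> 'I_D.+1}) : R :=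
  \prod_p (sdev R p ^+ (2 * b p) * ((b p)`!)%:R).

Lemma herm_norm_gt0 b : 0 < herm_norm b.
Proof.
apply: prodr_gt0 => p _; rewrite mulr_gt0 ?ltr0n ?fact_gt0//.
by rewrite exprM exprn_gt0// (lt_le_trans ltr01)// sqr_sdev_ge1.
Qed.

(* The g(W) with E[g(W) f(Y)] = E[f(Y) x]. *)
Definition dual w : R :=
  \sum_(b : {ffun pairT n -> 'I_D.+1} | (msize (ffnat b) <= D)%N)
    kap (ffnat b) / herm_norm b * \prod_p (hermite (sdev R p) (b p)).[w p].

Lemma polyfun_dual : polyfun dual.
Proof. by apply: polyfun_sum => a _; apply/polyfunZ/polyfun_prod. Qed.

Lemma EW_obs_dual v : EW (fun w => obs v w * dual w) =
  \sum_(a : {ffun 'I_n * 'I_n -> 'I_D.+1} | (\sum_q a q <= D)%N) c a *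
   \sum_(b : {ffun pairT n -> 'I_D.+1} | (msize (ffnat b) <= D)%N)
    kap (ffnat b) * \prod_p ((appell (sdev R p) (pushexp a p))^`N(b p)).[signal v p].
Proof.
pose m a b w := (c a * (kap (ffnat b) / herm_norm b)) *
  \prod_p (hermite (sdev R p) (b p) * ('X + (signal v p)%:P) ^+ pushexp a p).[w p].
have mP a b : polyfun (m a b) by apply/polyfunZ/polyfun_prod.
rewrite (_ : (fun w => _) = fun w =>
  \sum_(a : {ffun 'I_n * 'I_n -> 'I_D.+1} | (\sum_q a q <= D)%N)
   \sum_(b : {ffun pairT n -> 'I_D.+1} | (msize (ffnat b) <= D)%N) m a b w); last first.
  apply/funext => w; rewrite obsE /dual mulr_suml; apply: eq_bigr => a _.
  rewrite mulr_sumr; apply: eq_bigr => b _; rewrite /m mulrACA -big_split/=.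
  by congr (_ * _); apply: eq_bigr => p _; rewrite hornerM mulrC.
rewrite EW_sum; last by move=> a _; apply: polyfun_sum.
apply: eq_bigr => a _; rewrite EW_sum// mulr_sumr; apply: eq_bigr => b _.
rewrite /m EWZ ?EW_prod; last exact: polyfun_prod.
under eq_bigr do rewrite gaussL_hermite_translate ?sdev_neq0//.
rewrite big_split/= -/(herm_norm b) -!mulrA; congr (_ * (_ * _)).
by rewrite mulKf// gt_eqF// herm_norm_gt0.
Qed.

Lemma EW_dual_dual : EW (fun w => dual w * dual w) <= kappa_sum rho lam i0 D.
Proof.
pose m b b' w := (kap (ffnat b) / herm_norm b * (kap (ffnat b') / herm_norm b')) *
  \prod_p (hermite (sdev R p) (b p) * hermite (sdev R p) (b' p)).[w p].
have mP b b' : polyfun (m b b') by apply/polyfunZ/polyfun_prod.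
rewrite (_ : (fun w => _) = fun w =>
  \sum_(b : {ffun pairT n -> 'I_D.+1} | (msize (ffnat b) <= D)%N)
   \sum_(b' : {ffun pairT n -> 'I_D.+1} | (msize (ffnat b') <= D)%N) m b b' w); last first.
  apply/funext => w; rewrite /dual mulr_suml; apply: eq_bigr => b _.
  rewrite mulr_sumr; apply: eq_bigr => b' _; rewrite /m mulrACA -big_split/=.
  by congr (_ * _); apply: eq_bigr => p _; rewrite hornerM.
rewrite EW_sum; last by move=> b _; apply: polyfun_sum.
apply: ler_sum => b bD; rewrite EW_sum// (bigD1 b)//= [X in _ + X]big1 ?addr0; last first.
  move=> b' /andP[_ nbb']; rewrite /m EWZ ?EW_prod; last exact: polyfun_prod.
  have /existsP[p bp] : [exists p, b p != b' p].
    rewrite -negb_forall; apply: contraNN nbb' => /forallP h.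
    by apply/eqP/ffunP => p; apply/esym/eqP.
  rewrite (bigD1 p)//= gaussL_hermite_hermite ?sdev_neq0// ifF ?mul0r ?mulr0//.
  exact/negbTE.
rewrite /m EWZ ?EW_prod; last exact: polyfun_prod.
under eq_bigr do rewrite gaussL_hermite_hermite ?sdev_neq0// eqxx.
rewrite -/(herm_norm b) -mulrA divfK ?gt_eqF ?herm_norm_gt0// mulrAC -expr2.
rewrite ler_wpM2l ?sqr_ge0// lef_pV2 ?posrE ?herm_norm_gt0//; last first.
  by rewrite ltr0n /mfact prodn_gt0// => p; rewrite fact_gt0.
rewrite /mfact natr_prod; apply: ler_prod => p _; rewrite ler0n ffunE/=.
by rewrite ler_peMl// exprM exprn_ege1// sqr_sdev_ge1.
Qed.

(** Monomial by monomial, [kappa_prod_poly] is applied to the noise averages [appell], and its right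
    side is what Hermite integration gives on the other side. *)
Lemma EvY_obs_dual :
  EvY rho lam (fun v Y => polyD c Y * (v i0)%:R) =
  Ev rho (fun v => EW (fun w => obs v w * dual w)).
Proof.
rewrite /EvY; transitivity (Ev rho (fun v => (v i0)%:R * EW (obs v))).
  apply: eq_Ev => v; rewrite -EWZ; last exact: polyfun_obs.
  by congr EW; apply/funext => w; rewrite mulrC.
under eq_Ev do rewrite EW_obs mulr_sumr.
under [RHS]eq_Ev do rewrite EW_obs_dual.
rewrite !Ev_sum; apply: eq_bigr => a aD; rewrite EvZ.
under eq_Ev do rewrite mulrCA.
rewrite EvZ; congr (_ * _); rewrite (@kappa_prod_poly _ (pushexp a) D) ?sum_pushexp//.
  by rewrite Ev_sum; apply: eq_bigr => b _; rewrite EvZ.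
by move=> p; exact: size_appell.
Qed.

Lemma low_degree_bound : 0 <= rho <= 1 ->
  let Q := EvY rho lam (fun _ Y => polyD c Y ^+ 2) in
  0 <= Q /\ (Q != 0 ->
  EvY rho lam (fun v Y => polyD c Y * (v i0)%:R) ^+ 2 <= kappa_sum rho lam i0 D * Q).
Proof.
move=> rho01; rewrite EvY_obs_dual; set B := Ev rho _ => Q.
have Q0 : 0 <= Q by apply: Ev_ge0 => // v; apply: EW_ge0 => w; exact: sqr_ge0.
split=> // Qn0; have {Qn0} Qp : 0 < Q by rewrite lt_neqAle eq_sym Qn0.
set G := EW (fun w => dual w * dual w).
(* Cauchy-Schwarz from one square: its expectation is [Q * (Q * G - B^2)], and these coefficients
   avoid a case distinction on [G]. *)
have : 0 <= Ev rho (fun v => EW (fun w => (B * obs v w - Q * dual w) ^+ 2)).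
  by apply: Ev_ge0 => // v; apply: EW_ge0 => w; exact: sqr_ge0.
have E v : EW (fun w => (B * obs v w - Q * dual w) ^+ 2) =
   B ^+ 2 * EW (fun w => obs v w ^+ 2) + (- (2 * B * Q) * EW (fun w => obs v w * dual w) +
     Q ^+ 2 * G * 1).
  have po := polyfun_obs v; have pd := polyfun_dual.
  have p1 : polyfun (fun w => obs v w ^+ 2) by apply: polyfunM.
  have p2 := polyfunM po pd; have p3 := polyfunM pd pd.
  rewrite mulr1 -EWZ// -EWZ// -EWZ// -EWD; [|exact: polyfunZ|exact: polyfunZ].
  rewrite -EWD; [|exact: polyfunZ|apply: polyfunD; exact: polyfunZ].
  by congr EW; apply/funext => w; ring.
under eq_Ev do rewrite E.
rewrite EvD EvD !EvZ Ev1 -/B -[Ev _ _]/Q => H.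
have {}H : 0 <= Q * (Q * G - B ^+ 2).
  by move: H; congr (_ <= _); ring.
move: H; rewrite pmulr_rge0// subr_ge0 => /le_trans; apply.
by rewrite mulrC ler_wpM2r// EW_dual_dual.
Qed.

End Polynomial.

Lemma CorrD_sqr_le (D : nat) : 0 <= rho <= 1 ->
  CorrD rho lam i0 D ^+ 2 <= kappa_sum rho lam i0 D.
Proof.
move=> rho01; have K0 : 0 <= kappa_sum rho lam i0 D.
  by apply: sumr_ge0 => b _; rewrite divr_ge0 ?sqr_ge0.
rewrite /CorrD; set S := (X in sup X).
have SK r : S r -> `|r| <= Num.sqrt (kappa_sum rho lam i0 D).
  move=> [c [Q0 ->]]; have [Qge /(_ Q0) B] := @low_degree_bound D c rho01.
  have Qp : 0 < EvY rho lam (fun _ Y => polyD c Y ^+ 2) by rewrite lt_neqAle eq_sym Q0.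
  rewrite -sqrtr_sqr ler_sqrt// exprMn exprVn sqr_sqrtr// ler_pdivrMr//.
suff : `|sup S| <= Num.sqrt (kappa_sum rho lam i0 D).
  by move=> h; rewrite -(sqr_sqrtr K0) -ler_sqrt ?sqr_ge0// !sqrtr_sqr [leRHS]ger0_norm ?sqrtr_ge0.
(* An empty set has [sup] equal to 0 by convention; otherwise a member is needed to bound the
   supremum from below. *)
have [[x Sx]|S0] := pselect (exists x, S x); last first.
  by rewrite sup_out ?normr0 ?sqrtr_ge0// => -[/S0].
have ub : ubound S (Num.sqrt (kappa_sum rho lam i0 D)).
  by move=> y /SK; exact: le_trans (ler_norm _).
rewrite ler_norml; apply/andP; split; last by apply: ge_sup => //; exists x.
apply: (@le_trans _ _ x); first by have := SK _ Sx; rewrite ler_norml => /andP[].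
apply: ub_le_sup => //; by exists (Num.sqrt (kappa_sum rho lam i0 D)).
Qed.

End LowDegree.

(** * Elementary estimates *)

Section Estimates.
Variable R : realType.
Implicit Types (x r u : R) (t m n D : nat).

Lemma geometric_tail_le x t m : 0 <= x < 1 ->
  \sum_(k < m) (if (t <= k)%N then x ^+ k else 0) <= x ^+ t / (1 - x).
Proof.
move=> /andP[x0 x1]; have x10 : 0 < 1 - x by rewrite subr_gt0.
rewrite ler_pdivlMr//.
have -> : (\sum_(k < m) (if (t <= k)%N then x ^+ k else 0)) * (1 - x) =
    if (t <= m)%N then x ^+ t - x ^+ m else 0.
  elim: m => [|m IH].
    by rewrite big_ord0 mul0r leqn0; case: eqP => // ->; rewrite subrr.
  rewrite big_ord_recr/= mulrDl IH; have [tm|] := leqP t m.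
    by rewrite leqW// exprS; ring.
  move=> mt; rewrite mul0r addr0; case: ifP => // tm.
  by have -> : t = m.+1; [apply/eqP; rewrite eqn_leq tm mt | rewrite subrr].
by case: ifP => _; rewrite ?exprn_ge0// lerBlDr lerDl exprn_ge0.
Qed.

Lemma bernoulli_ge x m : 0 <= x <= 1 -> 1 - m%:R * x <= (1 - x) ^+ m.
Proof.
move=> /andP[x0 x1]; have x10 : 0 <= 1 - x by rewrite subr_ge0.
elim: m => [|m IH]; first by rewrite mul0r subr0 expr0.
rewrite exprSr; apply: (@le_trans _ _ ((1 - m%:R * x) * (1 - x))); last by rewrite ler_wpM2r.
have m0 : 0 <= m%:R :> R by [].
have := mulr_ge0 m0 (mulr_ge0 x0 x0); rewrite -[in X in _ -> X]natr1; nra.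
Qed.

(** Each step multiplies the left side by [(1 + 1/(t+1))^(t+1) <= e] times [t + 1]. It trades
    Cayley's count for the factorial in the binomial. *)
Lemma expS_le_expR_fact t : (t.+1)%:R ^+ t <= expR 1 ^+ t * t`!%:R :> R.
Proof.
elim: t => [|t IH]; first by rewrite !expr0 mul1r.
have t0 : 0 < t.+1%:R :> R by rewrite ltr0n.
have -> : t.+2%:R = t.+1%:R * (1 + t.+1%:R^-1) :> R.
  by rewrite mulrDr mulr1 divff ?gt_eqF// -natr1.
rewrite exprMn factS natrM.
have h : (1 + t.+1%:R^-1) ^+ t.+1 <= expR 1 :> R.
  rewrite -[in leRHS](divff (lt0r_neq0 t0)) expRM_natl.
  by rewrite lerXn2r ?nnegrE ?addr_ge0 ?invr_ge0 ?expR_ge0// expR_ge1Dx.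
apply: (@le_trans _ _ (t.+1%:R ^+ t.+1 * expR 1)).
  by rewrite ler_wpM2l// exprn_ge0.
rewrite exprSr [expR 1 ^+ t.+1]exprSr.
have -> : expR 1 ^+ t * expR 1 * (t.+1%:R * t`!%:R) =
   (expR 1 ^+ t * t`!%:R) * t.+1%:R * expR 1 :> R by ring.
by rewrite ler_wpM2r ?expR_ge0// ler_wpM2r.
Qed.

(** For [u < 1] this is exp(2u) <= (1+u)/(1-u). The difference of the two sides vanishes at 0 and
    has derivative [u * (expR u - expR (- u))]. *)
Lemma expR_pade u : 0 <= u -> (1 - u) * expR u <= (1 + u) * expR (- u).
Proof.
rewrite le_eqVlt => /orP[/eqP <-|u0]; first by rewrite !oppr0 !addr0.
pose f (y : R) := (1 + y) * expR (- y) - (1 - y) * expR y.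
pose f' (y : R) := y * (expR y - expR (- y)).
have df y : is_derive y (1 : R) f (f' y).
  rewrite /f; apply: is_derive_eq.
  by rewrite /f' /GRing.scale/= ; ring.
have cf : {within `[0, u]%classic, continuous f}.
  by apply: derivable_within_continuous => y _; have [] := df y.
have [c cu E] := @MVT R f f' 0 u u0 (fun y _ => df y) cf.
have : 0 <= f u - f 0.
  rewrite E subr0; move: cu; rewrite in_itv/= => /andP[c0 _].
  rewrite mulr_ge0 ?(ltW u0)// /f' mulr_ge0 ?(ltW c0)// subr_ge0 ler_expR.
  by rewrite ge0_cp// ltW.
have -> : f 0 = 0 by rewrite /f oppr0 expR0; ring.
by rewrite subr0 /f subr_ge0.
Qed.

(** The square of [(1 + 1/D)^(D + 1/2) >= e], free of the half power. At [u = 1/(2D+1)] the ratio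
    [(1+u)/(1-u)] is [(D+1)/D]. *)
Lemma expR2_le D : (0 < D)%N -> expR 1 ^+ 2 * D%:R ^+ (2 * D).+1 <= (D.+1%:R) ^+ (2 * D).+1 :> R.
Proof.
move=> D0; have D0' : 0 < D%:R :> R by rewrite ltr0n.
set N := (2 * D).+1; have N0 : 0 < N%:R :> R by rewrite ltr0n.
have NE : N%:R = 2 * D%:R + 1 :> R by rewrite /N -natr1 natrM.
pose u : R := N%:R^-1.
have u0 : 0 <= u by rewrite invr_ge0.
have H := expR_pade u0.
have H2 : D%:R * expR (2 * u) <= D.+1%:R.
  have e0 := expR_gt0 u.
  have : (1 - u) * (expR u * expR u) <= 1 + u.
    have := ler_wpM2r (ltW e0) H; rewrite -!mulrA [expR (- u) * _]mulrC expRxMexpNx_1 mulr1.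
    by [].
  rewrite -expRD -mulr2n -[u *+ 2]mulr_natl => H3.
  have E1 : 1 - u = 2 * D%:R * u by rewrite /u NE; field; lra.
  have E2 : 1 + u = 2 * D.+1%:R * u by rewrite /u NE -natr1; field; lra.
  move: H3; rewrite E1 E2 mulrAC ler_pM2r ?invr_gt0//.
  by rewrite -mulrA ler_pM2l.
have -> : expR 1 ^+ 2 = expR (2 * u) ^+ N.
  rewrite -expRM_natl -expRM_natl; congr expR; rewrite /u; field.
  by rewrite gt_eqF.
rewrite mulrC -exprMn lerXn2r ?nnegrE// mulr_ge0 ?expR_ge0//.
Qed.

(** Equality at [D = 1] fixes the constant [e]; the induction step is the square root of
    [expR2_le]. *)
Lemma fact_le_stirling D : (0 < D)%N ->
  D`!%:R * expR 1 ^+ D <= expR 1 * Num.sqrt D%:R * D%:R ^+ D :> R.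
Proof.
elim: D => // -[|D] IH _; first by rewrite (_ : 1`! = 1)%N// !expr1 sqrtr1 !mulr1 mul1r.
have {}IH := IH isT; set m := D.+1 in IH *.
have step : expR 1 * (Num.sqrt m%:R * m%:R ^+ m) <= Num.sqrt m.+1%:R * m.+1%:R ^+ m :> R.
  rewrite -(ler_sqr (_ : _ \is Num.nneg)) ?nnegrE ?mulr_ge0 ?expR_ge0 ?sqrtr_ge0 ?exprn_ge0//.
  rewrite !exprMn !sqr_sqrtr// -!exprM -!exprS mulnC.
  by rewrite expR2_le.
rewrite factS natrM [expR 1 ^+ m.+1]exprSr [m.+1%:R ^+ m.+1]exprS.
have e0 : 0 <= expR 1 :> R := expR_ge0 _.
have m0 : 0 <= m.+1%:R :> R by [].
have h1 := ler_wpM2l (mulr_ge0 m0 e0) IH.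
have h2 := ler_wpM2l (mulr_ge0 m0 e0) step.
apply: (le_trans (_ : _ <= m.+1%:R * expR 1 * (expR 1 * Num.sqrt m%:R * m%:R ^+ m))).
  by apply: le_trans h1; rewrite le_eqVlt; apply/orP; left; apply/eqP; ring.
rewrite -[X in _ * X <= _]mulrA; apply: (le_trans h2).
by rewrite le_eqVlt; apply/orP; left; apply/eqP; ring.
Qed.

Lemma leq_exp2rW m n t : (m <= n)%N -> (m ^ t <= n ^ t)%N.
Proof. by case: t => // t mn; rewrite leq_exp2r. Qed.

Lemma ffact_lower m n : (m <= n)%N -> ((n - m).+1 ^ m <= n ^_ m)%N.
Proof.
elim: m => // m IH mn; rewrite ffactnSr -subSn// subSS expnSr.
rewrite leq_mul// (leq_trans _ (IH (ltnW mn)))//.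
exact: leq_exp2rW.
Qed.

Lemma ffact_upper m n : (n ^_ m <= n ^ m)%N.
Proof.
by elim: m => // m IH; rewrite ffactnSr expnSr leq_mul// leq_subr.
Qed.

End Estimates.

(** * Counting trees *)

Local Close Scope classical_set_scope.

Section Arborescences.
Variable V : finType.
Implicit Types (A B J : {set V}) (p q : {ffun V -> V}) (v x y : V).

(* Parent functions on B, rooted in A; normalised to the identity outside B. *)
Definition arbor A B p :=
  [forall v, (v \notin B) ==> (p v == v)] &&
  [forall v, (v \in B) ==> [exists k : 'I_#|V|.+1, iter k p v \in A]].

(** The cut-off on [k] costs nothing: a point of an orbit is reached in fewer steps than the orbit
    has points. *)
Lemma arborP A B p : reflect
  [/\ forall v, v \notin B -> p v = v & forall v, v \in B -> exists k, iter k p v \in A]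
  (arbor A B p).
Proof.
apply: (iffP andP) => [[/forallP h1 /forallP h2]|[h1 h2]].
  split=> v vB; first by apply/eqP; have := h1 v; rewrite vB.
  by have := h2 v; rewrite vB => /existsP[k]; exists k.
split; first by apply/forallP => v; apply/implyP => /h1 ->.
apply/forallP => v; apply/implyP => /h2[k kA].
have /iter_findex E : fconnect p v (iter k p v) by exact: fconnect_iter.
have lt : (findex p v (iter k p v) < #|V|.+1)%N.
  by rewrite ltnS (leq_trans (ltnW (findex_max (fconnect_iter _ _ _))))// max_card.
by apply/existsP; exists (Ordinal lt); rewrite /= E.
Qed.

Lemma iter_fix p v k : p v = v -> iter k p v = v.
Proof. by move=> pv; elim: k => //= k ->. Qed.

Lemma arbor_parent A B p v : arbor A B p -> v \in B -> v \notin A ->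
  p v \in A :|: B.
Proof.
move=> /arborP[h1 h2] vB vA; rewrite finset.in_setU; apply/orP.
have [|pB] := boolP (p v \in B); [by right|left].
have [[|k]] := h2 _ vB; first by rewrite /= (negbTE vA).
by rewrite iterSr (iter_fix _ (h1 _ pB)).
Qed.

Definition layer A B p : {set V} := [set v in B | p v \in A].

(** Peel off the vertices [J] whose parent lies in [A]: on [J] the map is any function into [A],
    elsewhere it is a forest rooted in [J]. The point [y0] only pads functions on [J] to total
    ones. *)
Lemma card_arbor_layer y0 A B J : [disjoint A & B] -> J \subset B ->
  #|[set p | arbor A B p && (layer A B p == J)]| =
  (#|A| ^ #|J| * #|[set q | arbor J (B :\: J) q]|)%N.
Proof.
move=> dAB JB.
have AB v : v \in A -> v \notin B by move=> vA; rewrite (disjointFr dAB vA).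
have sJB v : v \in J -> v \in B by exact: (fintype.subsetP JB).
pose F : {set {ffun V -> V}} := [set f in pffun_on y0 (mem J) (mem A)].
pose Q : {set {ffun V -> V}} := [set q | arbor J (B :\: J) q].
pose g (x : {ffun V -> V} * {ffun V -> V}) : {ffun V -> V} :=
  [ffun v => if v \in J then x.1 v else x.2 v].
have FP f : f \in F -> (forall v, v \notin J -> f v = y0) /\ (forall v, v \in J -> f v \in A).
  rewrite inE => /pffun_onP[/fintype.subsetP s fA]; split=> v vJ.
    by apply/eqP; apply: contraNT vJ => fv; apply: s; rewrite inE.
  by apply: fA; apply/fintype.imageP; exists v.
have QP q : q \in Q -> (forall v, v \notin B :\: J -> q v = v) /\
    (forall v, v \in B :\: J -> exists k, iter k q v \in J).
  by rewrite inE => /arborP[].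
have -> : [set p | arbor A B p && (layer A B p == J)] = g @: finset.setX F Q.
  apply/setP => p; apply/idP/imsetP.
    rewrite inE => /andP[ap /eqP lJ]; have /arborP[h1 h2] := ap.
    have inJ v : (v \in J) = (v \in B) && (p v \in A) by rewrite -lJ inE.
    pose f : {ffun V -> V} := [ffun v => if v \in J then p v else y0].
    pose q : {ffun V -> V} := [ffun v => if v \in B :\: J then p v else v].
    exists (f, q).
      rewrite finset.in_setX /= !inE; apply/andP; split.
        apply/pffun_onP; split.
          apply/fintype.subsetP => v; rewrite inE ffunE.
          by apply: contraR => vJ; rewrite (negbTE vJ).
        move=> y /fintype.imageP[v vJ ->]; rewrite ffunE vJ.
        by move: vJ; rewrite inJ => /andP[].
      apply/arborP; split=> v; first by move=> vBJ; rewrite ffunE (negbTE vBJ).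
      rewrite finset.in_setD => /andP[_ vB]; have [k] := h2 _ vB.
      elim: k v vB => [|k IH] v vB; first by move/AB; rewrite vB.
      have [vJ _|vJ] := boolP (v \in J); first by exists 0%N.
      have qv : q v = p v by rewrite ffunE finset.in_setD vJ vB.
      have npA : p v \notin A by move: vJ; rewrite inJ vB.
      rewrite iterSr => kA; have pB : p v \in B.
        apply: contraNT npA => /h1 pv; by rewrite (iter_fix _ pv) in kA.
      have [j jJ] := IH _ pB kA; exists j.+1; by rewrite iterSr qv.
    apply/ffunP => v; rewrite ffunE /=; case: ifP => vJ; first by rewrite ffunE vJ.
    by rewrite ffunE finset.in_setD vJ /=; case: ifP => // /negbT /h1.
  move=> [[f q]]; rewrite finset.in_setX /= => /andP[/FP[f1 f2] /QP[q1 q2]] -> {p}.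
  set p := g _; have pJ v : v \in J -> p v = f v by move=> vJ; rewrite ffunE vJ.
  have pnJ v : v \notin J -> p v = q v by move=> vJ; rewrite ffunE (negbTE vJ).
  rewrite inE; apply/andP; split.
    apply/arborP; split=> v vB.
      have vJ : v \notin J by apply: contraNN vB => /sJB.
      by rewrite pnJ// q1// finset.in_setD (negbTE vB) andbF.
    have [k] : exists k, iter k q v \in J.
      have [vJ|vJ] := boolP (v \in J); first by exists 0%N.
      by apply: q2; rewrite finset.in_setD vJ.
    elim: k v {vB} => [|k IH] v; first by move=> /= vJ; exists 1%N; rewrite /= pJ// f2.
    have [vJ _|vJ] := boolP (v \in J); first by exists 1%N; rewrite /= pJ// f2.
    by rewrite iterSr -pnJ// => /IH[j jA]; exists j.+1; rewrite iterSr.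
  apply/eqP/setP => v; rewrite inE; have [vJ|vJ] := boolP (v \in J).
    by rewrite sJB// pJ// f2.
  apply/negbTE/negP => /andP[vB]; rewrite pnJ// => qA.
  have [[|k]] : exists k, iter k q v \in J by apply: q2; rewrite finset.in_setD vJ.
    by rewrite /= (negbTE vJ).
  have qq : q (q v) = q v by apply: q1; rewrite finset.in_setD (negbTE (AB _ qA)) andbF.
  by rewrite iterSr (iter_fix _ qq) => /sJB; apply/negP/AB.
rewrite card_in_imset.
  rewrite finset.cardsX [#|F|](_ : _ = #|A| ^ #|J|)%N// cardsE.
  by rewrite -(card_pffun_on y0 (mem J) (mem A)); apply: eq_card.
move=> [f q] [f' q']; rewrite !finset.in_setX /= => /andP[/FP[f1 _] /QP[q1 _]].
move=> /andP[/FP[f1' _] /QP[q1' _]] /ffunP E; congr pair; apply/ffunP => v.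
  have [vJ|vJ] := boolP (v \in J); last by rewrite f1// f1'.
  by have := E v; rewrite !ffunE vJ.
have [vJ|vJ] := boolP (v \in J).
  by rewrite q1 ?q1'// finset.in_setD vJ.
by have := E v; rewrite !ffunE (negbTE vJ).
Qed.

Lemma card_arbor_set0 A : #|[set p | arbor A finset.set0 p]| = 1%N.
Proof.
apply/eqP/finset.cards1P; exists [ffun v => v]; apply/setP => p; rewrite !inE.
apply/arborP/eqP => [[h _]|->].
  by apply/ffunP => v; rewrite ffunE h// finset.in_set0.
by split=> v; rewrite ?ffunE// finset.in_set0.
Qed.

(* Cayley's formula for rooted forests. *)
Lemma card_arbor A B : [disjoint A & B] -> (0 < #|B|)%N ->
  #|[set p | arbor A B p]| = (#|A| * (#|A| + #|B|) ^ #|B|.-1)%N.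
Proof.
have [m] := ubnP #|B|; elim: m A B => // m IH A B; rewrite ltnS => Bm dAB B0.
have [y0 _] : exists y0, y0 \in B by apply/set0Pn; rewrite -card_gt0.
(* The count on [B :\: J] is [|J| |B|^(|B|-|J|-1)]; multiplying by [|B|] removes the exponent -1
   that [J = B] would give. *)
have IH' J : J \subset B -> (0 < #|J|)%N ->
    (#|[set q | arbor J (B :\: J) q]| * #|B| = #|J| * #|B| ^ (#|B| - #|J|))%N.
  move=> JB J0; have cD : #|B :\: J| = (#|B| - #|J|)%N.
    by rewrite finset.cardsD (finset.setIidPr JB).
  have [|D0] := posnP #|B :\: J|.
    move=> /eqP; rewrite finset.cards_eq0 => /eqP BJ0; rewrite BJ0 card_arbor_set0.
    have : (#|B| - #|J| = 0)%N by rewrite -cD BJ0 finset.cards0.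
    move=> z; rewrite z expn0 mul1n muln1; apply/eqP.
    by rewrite eqn_leq (subset_leq_card JB) andbT -subn_eq0 z.
  rewrite IH//.
  - have -> : (#|J| + #|B :\: J| = #|B|)%N by rewrite cD subnKC// subset_leq_card.
    by rewrite -mulnA -expnSr prednK// cD.
  - by apply: leq_trans Bm; rewrite cD ltn_subrL J0 B0.
  - by rewrite disjoint_sym -setI_eq0 finset.setIDAC finset.setDIl; apply/eqP/setP => z;
       rewrite !inE; case: (z \in J); rewrite ?andbF.
transitivity (\sum_(J : {set V} | J \subset B)
    #|[set p | arbor A B p && (layer A B p == J)]|)%N.
  rewrite -sum1_card (partition_big (layer A B) (fun J => J \subset B)) /=.
    apply: eq_bigr => J _; rewrite -sum1_card; apply: eq_bigl => p.
    by rewrite !inE.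
  by move=> p _; apply/fintype.subsetP => v; rewrite inE => /andP[].
under eq_bigr => J JB do rewrite (card_arbor_layer y0 dAB JB).
rewrite (partition_big (fun J : {set V} => inord #|J| : 'I_#|B|.+1) xpredT)//=.
set a := #|A|; set b := #|B|.
have E (j : 'I_b.+1) : ((\sum_(J : {set V} | (J \subset B) && (inord #|J| == j :> 'I_b.+1))
    a ^ #|J| * #|[set q | arbor J (B :\: J) q]|) * b =
    'C(b, j) * (a ^ j * (j * b ^ (b - j))))%N.
  rewrite big_distrl /= -cards_draws -sum1_card big_distrl /=.
  apply: eq_big => [J|J /andP[JB]].
    rewrite inE; apply: andb_id2l => JB.
    by rewrite -val_eqE /= inordK// ltnS subset_leq_card.
  rewrite -val_eqE /= inordK ?ltnS ?subset_leq_card// => /eqP Jj.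
  have [j0|j0] := posnP j; last by rewrite -mulnA IH' ?Jj// mul1n.
  have J00 : J = finset.set0 by apply/eqP; rewrite -finset.cards_eq0 Jj j0.
  rewrite j0 mul0n !muln0 J00 finset.setD0.
  rewrite [X in (_ * X * _)%N](_ : _ = 0)%N ?muln0//; apply/eqP; rewrite finset.cards_eq0; apply/eqP/setP => q.
  rewrite [RHS]inE; apply/negbTE; rewrite inE; apply/negP => /arborP[_ h].
  have /set0Pn[z zB] : B != finset.set0 by rewrite -card_gt0.
  by have [k] := h _ zB; rewrite finset.in_set0.
(* After multiplication by [b], the identity [j C(b, j) = b C(b-1, j-1)] reduces the sum to the
   binomial theorem. *)
apply/eqP; rewrite -(eqn_pmul2r B0) -/b big_distrl /=; apply/eqP.
under eq_bigr do rewrite E.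
rewrite big_ord_recl /= mul0n !muln0 add0n.
have b0 : (0 < b)%N := B0.
clear E; clearbody a b; case: b b0 => // c _; rewrite [(a + _)%N]addnC /=.
rewrite expnDn mulnAC big_distrr /=; apply: eq_bigr => i _.
rewrite /bump leq0n add1n.
have /= h := mul_bin_diag c.+1 i.
rewrite (_ : c.+1 - i.+1 = c - i)%N//.
transitivity (a * (i.+1 * 'C(c.+1, i.+1)) * (c.+1 ^ (c - i) * a ^ i))%N.
  by rewrite expnS; ring.
by rewrite -h; ring.
Qed.

End Arborescences.

(** * Rooted trees as multi-indices *)

Section TreeIndex.
Variables (n : nat) (i0 : 'I_n).
Implicit Types (U : {set 'I_n}) (p q : {ffun 'I_n -> 'I_n}) (a : {ffun pairT n -> nat}).

Definition treeidx U p : {ffun pairT n -> nat} :=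
  [ffun e => (\sum_(v in U) (pidx v (p v) == e))%N].

Local Notation arb := (arbor [set i0]).

Lemma pidx_inj (i j k l : 'I_n) : pidx i j = pidx k l -> i = k /\ j = l \/ i = l /\ j = k.
Proof.
move=> /(congr1 val); rewrite !val_pidx.
by case: ifP => _; case: ifP => _ [-> ->]; [left|right|right|left].
Qed.

Lemma msize_treeidx U p : msize (treeidx U p) = #|U|.
Proof.
rewrite /msize; under eq_bigr do rewrite ffunE.
rewrite exchange_big /= -sum1_card; apply: eq_bigr => v _.
by rewrite (bigD1 (pidx v (p v)))//= eqxx big1 ?addn0// => e; rewrite eq_sym => /negbTE ->.
Qed.

Lemma treeidx_gt0P U p e :
  reflect (exists2 v, v \in U & pidx v (p v) = e) (0 < treeidx U p e)%N.
Proof.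
rewrite ffunE; apply: (iffP idP) => [|[v vU <-]]; last by rewrite (bigD1 v)//= eqxx.
rewrite lt0n sum_nat_eq0 negb_forall => /existsP[v]; rewrite negb_imply => /andP[vU].
by rewrite eqb0 negbK => /eqP ve; exists v.
Qed.

Lemma arb_parent U p v : i0 \notin U -> arb U p -> v \in U -> p v \in (i0 |: U).
Proof.
move=> iU ap vU; apply: (arbor_parent ap vU); rewrite finset.in_set1.
by apply: contraNneq iU => <-.
Qed.

Lemma arb_nocycle U p v : i0 \notin U -> arb U p -> v \in U -> p v \in U -> p (p v) <> v.
Proof.
move=> iU /arborP[_ h] vU pU pp; have [k] := h _ vU.
have /orP st : (iter k p v == v) || (iter k p v == p v).
  by elim: k => /= [|k /orP[/eqP ->|/eqP ->]]; rewrite ?eqxx ?orbT// pp eqxx.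
rewrite finset.in_set1 => /eqP E; move: iU; rewrite -E.
by case: st => /eqP ->; rewrite ?vU ?pU.
Qed.

(** An edge counted twice would join two vertices that are each other's parent, a cycle that never
    reaches the root. *)
Lemma treeidx_le1 U p e : i0 \notin U -> arb U p -> (treeidx U p e <= 1)%N.
Proof.
move=> iU ap; rewrite leqNgt; apply/negP => lt.
have /treeidx_gt0P[v vU ve] : (0 < treeidx U p e)%N by apply: ltn_trans lt.
move: lt; rewrite ffunE (bigD1 v)//= ve eqxx add1n ltnS lt0n sum_nat_eq0 negb_forall.
move=> /existsP[w]; rewrite negb_imply => /andP[/andP[wU wv]]; rewrite eqb0 negbK => /eqP we.
have := pidx_inj (etrans ve (esym we)); case=> -[E1 E2]; first by rewrite E1 eqxx in wv.
by apply: (arb_nocycle iU ap vU); rewrite E2// -E1.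
Qed.

Lemma verts_treeidx U p : i0 \notin U -> arb U p -> (i0 |: verts (treeidx U p)) = i0 |: U.
Proof.
move=> iU ap; apply/setP => i; apply/finset.setU1P/idP.
  case=> [->|/vertsP[e /treeidx_gt0P[v vU <-]]]; first by rewrite finset.setU11.
  rewrite incident_pidx => /orP[/eqP ->|/eqP ->]; last exact: arb_parent.
  by rewrite finset.in_setU vU orbT.
move=> /finset.setU1P[->|iU']; [by left|right].
apply/vertsP; exists (pidx i (p i)); last by rewrite incident_pidx eqxx.
by apply/treeidx_gt0P; exists i.
Qed.

Lemma conn_treeidx U p : i0 \notin U -> arb U p -> conn i0 (treeidx U p).
Proof.
move=> iU ap; apply/fintype.subsetP => v vv.
have : v \in i0 |: U by rewrite -(verts_treeidx iU ap) finset.in_setU vv orbT.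
move=> /finset.setU1P vU0; rewrite inE; case: vU0 => [->|vU]; first exact: connect0.
have [_ /(_ _ vU)[k]] := arborP _ _ _ ap; rewrite finset.in_set1 => /eqP.
have sy : connect_sym (adj (treeidx U p)).
  by apply: sym_connect_sym => x y; rewrite /adj pidxC.
elim: k v {vv} vU => [|k IH] v vU; first by move=> /= E; rewrite E (negbTE iU) in vU.
rewrite iterSr => kE.
have e1 : connect (adj (treeidx U p)) (p v) v.
  by rewrite sy; apply: connect1; apply/treeidx_gt0P; exists v.
case/finset.setU1P: (arb_parent iU ap vU) => [<-//|pU].
exact: connect_trans (IH _ pU kE) e1.
Qed.

(** Induction on the distance to the root. The edge from [v] to [p v] is also an edge of [q]; if it
    came from [p v] there, then [p (p v) = v] by induction, a 2-cycle. *)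
Lemma treeidx_inj U U' p q : i0 \notin U -> i0 \notin U' -> arb U p -> arb U' q ->
  treeidx U p = treeidx U' q -> U = U' /\ p = q.
Proof.
move=> iU iU' ap aq E.
have UU : U = U'.
  rewrite -(setU1K iU) -(setU1K iU') -(verts_treeidx iU ap) -(verts_treeidx iU' aq).
  by rewrite E.
subst U'; split=> //; apply/ffunP => v.
have [/arborP[p1 p2] /arborP[q1 _]] := (ap, aq).
have [vU|vU] := boolP (v \in U); last by rewrite p1// q1.
have [k] := p2 _ vU; rewrite finset.in_set1 => /eqP.
elim: k v vU => [|k IH] v vU; first by move=> /= vE; rewrite vE (negbTE iU) in vU.
rewrite iterSr => kE.
have /treeidx_gt0P[x xU] : (0 < treeidx U q (pidx v (p v)))%N.
  by rewrite -E; apply/treeidx_gt0P; exists v.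
move=> /pidx_inj[[<- <-]//|[xE qE]].
have ppv : p (p v) = v by rewrite -xE (IH x xU)// xE.
by case: (arb_nocycle iU ap vU _ ppv); rewrite -xE.
Qed.

Lemma arb_extend U p u w : i0 \notin U -> arb U p -> u \in i0 |: U -> w \notin i0 |: U ->
  arb (w |: U) [ffun x => if x == w then u else p x].
Proof.
move=> iU ap uU wU; have /arborP[h1 h2] := ap; apply/arborP; set p' := finfun _.
have p'E x : x != w -> p' x = p x by rewrite ffunE => /negbTE ->.
have reach k v : v \in i0 |: U -> iter k p v \in [set i0] ->
    exists j, iter j p' v \in [set i0].
  elim: k v => [|k IH] v vU; first by exists 0%N.
  have [vi|vi] := eqVneq v i0; first by exists 0%N; rewrite /= vi finset.in_set1.
  have vU' : v \in U by move: vU; rewrite finset.in_setU finset.in_set1 (negbTE vi).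
  have vw : v != w by apply: contraNneq wU => <-.
  rewrite iterSr => /(IH _ (arb_parent iU ap vU'))[j jE].
  by exists j.+1; rewrite iterSr p'E.
have rU v : v \in i0 |: U -> exists j, iter j p' v \in [set i0].
  move=> /[dup] vU /finset.setU1P[->|/h2[k]]; last exact: reach.
  by exists 0%N; rewrite /= finset.in_set1.
split=> v; rewrite finset.in_setU finset.in_set1.
  by rewrite negb_or => /andP[vw vU]; rewrite p'E// h1.
move=> /orP[/eqP ->|vU]; last by apply: rU; rewrite finset.in_setU vU orbT.
by have [j jE] := rU _ uU; exists j.+1; rewrite iterSr ffunE eqxx.
Qed.

(** Take a maximal vertex set carrying a tree inside [a]. An edge leaving it would attach one more
    leaf, so with the root it is closed and contains the component of the root. *)
Lemma spanning_arb a : conn i0 a -> exists p,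
  arb (verts a :\ i0) p /\ forall e, (treeidx (verts a :\ i0) p e <= a e)%N.
Proof.
move=> ca; pose P U := (i0 \notin U) &&
  [exists p, arb U p && [forall v in U, (0 < a (pidx v (p v)))%N]].
have [|U /maxsetP[/andP[iU /existsP[p /andP[ap /forall_inP pa]]] Umax]] := @ex_maxset _ P.
  exists finset.set0; rewrite /P finset.in_set0 /=; apply/existsP; exists [ffun x => x].
  apply/andP; split; last by apply/forall_inP => v; rewrite finset.in_set0.
  by apply/arborP; split=> v; rewrite ?ffunE// finset.in_set0.
have stop u w e : (0 < a e)%N -> incident u e -> incident w e ->
    u \in i0 |: U -> w \in i0 |: U.
  move=> ae ue we uU; apply: contraT => wU.
  have uw : u != w by apply: contraNneq wU => <-.
  have eE : e = pidx w u.
    move: uw; rewrite (pidx_incident we); move: ue we; rewrite /incident.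
    by case: (val e) => x y /=; do 2!case/orP => /eqP ->; rewrite ?eqxx// => h; rewrite eq_sym (negbTE h).
  have wU0 : w \notin U by apply: contraNN wU => h; rewrite finset.in_setU h orbT.
  have : P (w |: U).
    rewrite /P finset.in_setU finset.in_set1 negb_or iU andbT; apply/andP; split.
      by apply: contraNneq wU => <-; rewrite finset.setU11.
    apply/existsP; exists [ffun x => if x == w then u else p x].
    rewrite arb_extend//=; apply/forall_inP => v; rewrite ffunE finset.in_setU finset.in_set1.
    by case: eqP => [-> _|_ /= /pa//]; rewrite -eE.
  move=> /Umax/(_ (finset.subsetUr _ _)) UE.
  by rewrite -UE finset.setU11 in wU0.
have cl : edge_closed a (i0 |: U).
  by move=> e i j ae ie je; apply/idP/idP; [exact: (stop i j e)|exact: (stop j i e)].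
have sub := fintype.subset_trans ca (comp_sub (finset.setU11 _ _) cl).
have UE : verts a :\ i0 = U.
  apply/setP => v; rewrite finset.in_setD1; apply/andP/idP => [[vi]|vU].
    by move=> /(fintype.subsetP sub)/finset.setU1P[vE|//]; rewrite vE eqxx in vi.
  split; first by apply: contraNneq iU => <-.
  by apply/vertsP; exists (pidx v (p v)); [exact: pa|rewrite incident_pidx eqxx].
exists p; rewrite UE; split=> // e; have [->//|] := posnP (treeidx U p e).
move=> t0; apply: (leq_trans (treeidx_le1 e iU ap)).
by have /treeidx_gt0P[v vU <-] := t0; exact: pa.
Qed.

Lemma card_arb U : i0 \notin U -> #|[set p | arb U p]| = (#|U|.+1 ^ #|U|.-1)%N.
Proof.
move=> iU; have [U0|U0] := posnP #|U|.
  move/eqP: (U0); rewrite finset.cards_eq0 => /eqP ->.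
  by rewrite card_arbor_set0 finset.cards0.
by rewrite card_arbor ?finset.cards1 ?mul1n ?add1n// finset.disjoints1.
Qed.

Definition inner (S : {set 'I_n}) (e : pairT n) := ((val e).1 \in S) && ((val e).2 \in S).

(** The pairs with [i <= j] and those with [j <= i] cover [S x S] and meet in the diagonal; loops
    are counted. *)
Lemma card_inner (S : {set 'I_n}) : (#|inner S|.*2 = #|S| * #|S|.+1)%N.
Proof.
pose le := [set x : 'I_n * 'I_n in finset.setX S S | (x.1 <= x.2)%N].
pose ge := [set x : 'I_n * 'I_n in finset.setX S S | (x.2 <= x.1)%N].
have leE : #|inner S| = #|le|.
  rewrite -(card_imset _ (@val_inj _ _ (pairT n))) -[in LHS]cardsE; apply: eq_card => x.
  rewrite !inE; apply/imsetP/andP.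
    by case=> e eS ->; split; [|exact: (valP e)].
  by case=> xS xle; exists (exist _ x xle).
have geE : #|ge| = #|le|.
  pose sw (x : 'I_n * 'I_n) := (x.2, x.1).
  have swI : injective sw by move=> [a b] [c d] [-> ->].
  rewrite -(card_imset _ swI).
  apply: eq_card => -[x y]; rewrite !inE/=; apply/imsetP/idP.
    by case=> -[z t]; rewrite !inE /= => /andP[/andP[zS tS] zt] [-> ->]; rewrite zS tS zt.
  by move=> /andP[/andP[xS yS] xy]; exists (y, x) => //; rewrite !inE /= xS yS xy.
have UI : (#|le :|: ge| + #|le :&: ge| = #|S| * #|S|.+1)%N.
  rewrite mulnS addnC; congr (_ + _)%N.
    rewrite -(card_imset (mem S) (fun x y (e : (x, x) = (y, y)) => congr1 fst e)).
    apply: eq_card => -[x y]; rewrite !inE/=; apply/idP/imsetP.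
      move=> /andP[/andP[/andP[xS _] xy] /andP[_ yx]]; exists x => //; congr pair.
      by apply/val_inj/eqP; rewrite eqn_leq xy yx.
    by case=> z zS [-> ->]; rewrite zS leqnn.
  rewrite -finset.cardsX; apply: eq_card => -[x y]; rewrite !inE/=.
  by case: (x \in S) (y \in S) => -[]//=; exact: leq_total.
by rewrite -addnn -UI cardsUI geE leE.
Qed.

End TreeIndex.

(** * Bounds on the sum of kappa^2 / a! *)

Section KappaSum.
Variables (R : realType) (n : nat) (rho lam : R) (i0 : 'I_n).
Implicit Types (U : {set 'I_n}) (p : {ffun 'I_n -> 'I_n}).
Local Notation kap := (kappa rho lam i0).
Local Notation arb := (arbor [set i0]).

(** The sum is bounded by a product over pairs: inside [i0 |: U] a geometric series starting at the
    tree's exponent, outside it the exponent 0 alone. *)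
Lemma sum_above_tree D (x : R) U p : 0 <= x < 1 -> i0 \notin U -> arb U p ->
  \sum_(a : {ffun pairT n -> 'I_D.+1} |
      lef (treeidx U p) (ffnat a) && (verts (ffnat a) \subset i0 |: U))
    x ^+ msize (ffnat a) <= x ^+ #|U| * (1 - x)^-1 ^+ #|inner (i0 |: U)|.
Proof.
move=> x01 iU ap; have /andP[x0 x1] := x01; set S := i0 |: U.
have x10 : 0 < 1 - x by rewrite subr_gt0.
pose G (e : pairT n) (k : 'I_D.+1) : R :=
  if inner S e then (if (treeidx U p e <= k)%N then x ^+ k else 0) else (k == 0%N :> nat)%:R.
have G0 e k : 0 <= G e k by rewrite /G; case: ifP => _; [case: ifP => _|]; rewrite ?exprn_ge0.
apply: (@le_trans _ _ (\sum_(a : {ffun pairT n -> 'I_D.+1}) \prod_e G e (a e))).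
  rewrite big_mkcond; apply: ler_sum => a _; case: ifP => [/andP[/lefP ta /fintype.subsetP aS]|_].
    rewrite /msize -prodrXr le_eqVlt; apply/orP; left; apply/eqP; apply: eq_bigr => e _.
    rewrite /G; case: ifP => [_|eS]; first by move: (ta e); rewrite [ffnat a e]ffunE => ->.
    have [a0|a0] := posnP (a e); first by rewrite ffunE a0 expr0.
    have h i : incident i e -> i \in S.
      by move=> ie; apply: aS; apply/vertsP; exists e; rewrite // ffunE.
    by move: eS; rewrite /inner !h// /incident eqxx ?orbT.
  by apply: prodr_ge0.
rewrite -(bigA_distr_bigA G).
apply: (@le_trans _ _ (\prod_(e : pairT n)
    (x ^+ treeidx U p e * (if inner S e then (1 - x)^-1 else 1)))); last first.
  rewrite big_split/= prodrXr -/(msize (treeidx U p)) msize_treeidx.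
  by rewrite -big_mkcond/= prodr_const.
apply: ler_prod => e _; rewrite sumr_ge0//= /G; case: ifP => eS.
  exact: geometric_tail_le.
rewrite mulr1 (_ : treeidx U p e = 0%N); last first.
  apply/eqP; rewrite -leqn0 leqNgt; apply: contraFN eS => te.
  have tS : verts (treeidx U p) \subset S.
    by rewrite /S -(verts_treeidx iU ap) finset.subsetUr.
  have h i : incident i e -> i \in S.
    by move=> ie; apply: (fintype.subsetP tS); apply/vertsP; exists e.
  by rewrite /inner !h// /incident eqxx ?orbT.
rewrite expr0 (bigD1 ord0)//= big1 ?addr0// => k.
by rewrite -val_eqE /= => /negbTE ->.
Qed.

Lemma sum_arb (K : nat) (f : nat -> R) :
  \sum_(U : {set 'I_n} | (i0 \notin U) && (#|U| <= K)%N)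
     \sum_(p : {ffun 'I_n -> 'I_n} | arb U p) f #|U| =
  \sum_(t < K.+1) ('C(n.-1, t) * t.+1 ^ t.-1)%:R * f t.
Proof.
rewrite (partition_big (fun U : {set 'I_n} => inord #|U| : 'I_K.+1) xpredT)//=.
apply: eq_bigr => t _.
transitivity (\sum_(U : {set 'I_n} | (U \subset [set~ i0]) && (#|U| == t))
    ((t.+1 ^ t.-1)%:R * f t)).
  apply: eq_big => [U|U /andP[/andP[iU UK]]].
    have -> : (U \subset [set~ i0]) = (i0 \notin U).
      apply/fintype.subsetP/idP => [h|iU v vU]; first by apply/negP => /h; rewrite !inE eqxx.
      by rewrite !inE; apply: contraNneq iU => <-.
    case: (i0 \in U) => //=.
    have [UK|UK] /= := leqP #|U| K; first by rewrite -val_eqE /= inordK.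
    by apply/esym/negbTE; apply: contraTneq UK => ->; rewrite -leqNgt -ltnS.
  rewrite -val_eqE /= inordK// => /eqP <-.
  by rewrite sumr_const -(card_arb iU) mulr_natl cardsE.
rewrite sumr_const (_ : #|_| = 'C(n.-1, t)); first by rewrite -[_ *+ 'C(_, _)]mulr_natl natrM mulrA.
by rewrite -[n in RHS]card_ord -(finset.cardsC1 i0) -cards_draws -[RHS]cardsE; apply: eq_card => U; rewrite !inE.
Qed.

Lemma kappa_sum_le_trees D : 0 < rho < 1 -> 0 <= lam < 1 -> 2 ^+ D.+1 * rho <= 1 ->
  kappa_sum rho lam i0 D <=
  \sum_(U : {set 'I_n} | (i0 \notin U) && (#|U| <= D)%N)
     \sum_(p : {ffun 'I_n -> 'I_n} | arb U p)
       rho ^+ (2 * #|U|.+1) * ((lam ^+ 2) ^+ #|U| * (1 - lam ^+ 2)^-1 ^+ #|inner (i0 |: U)|).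
Proof.
move=> r01 /andP[l0 l1] Dr; have /andP[r0 r1] := r01.
set x := lam ^+ 2.
have x01 : 0 <= x < 1 by rewrite sqr_ge0 expr_lt1.
have x0 : 0 <= x by case/andP: x01.
pose W (a : {ffun pairT n -> nat}) := x ^+ msize a * rho ^+ (2 * #|i0 |: verts a|).
have W0 a : 0 <= W a by rewrite mulr_ge0 ?exprn_ge0 ?(ltW r0).
have root_verts (a : {ffun pairT n -> nat}) : i0 |: (verts a :\ i0) = i0 |: verts a.
  by apply/setP => i; rewrite !inE; case: (i == i0).
apply: (@le_trans _ _ (\sum_(a : {ffun pairT n -> 'I_D.+1} |
    (msize (ffnat a) <= D)%N && conn i0 (ffnat a)) W (ffnat a))).
  rewrite /kappa_sum (bigID (fun a : {ffun pairT n -> 'I_D.+1} => conn i0 (ffnat a)))/=.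
  rewrite [X in _ + X]big1 ?addr0; last first.
    by move=> a /andP[_ /kappa_disconnected ->]; rewrite expr0n mul0r.
  apply: ler_sum => a /andP[aD ca].
  have ra : 2 ^+ (msize (ffnat a)).+1 * rho <= 1.
    by apply: le_trans Dr; rewrite ler_wpM2r ?(ltW r0)// ler_weXn2l ?ler1n ?ltnS.
  have [/andP[k0 k1] _] := kappa_bounds i0 r01 l0 ra.
  apply: (@le_trans _ _ (kap (ffnat a) ^+ 2)).
    rewrite ler_piMr ?sqr_ge0// invf_le1 ?ler1n ?ltr0n /mfact ?prodn_gt0// => e;
    by rewrite fact_gt0.
  rewrite /W /x -!exprM -[(2 * #|_|)%N]mulnC -mulnC !exprM -exprMn ?lerXn2r ?nnegrE//.
  by rewrite (le_trans k0).
rewrite (partition_big (fun a : {ffun pairT n -> 'I_D.+1} => verts (ffnat a) :\ i0)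
  (fun U => (i0 \notin U) && (#|U| <= D)%N)) /=; last first.
  move=> a /andP[aD ca]; rewrite finset.setD11 /=.
  have [p [_ tp]] := spanning_arb ca; apply: leq_trans aD.
  by rewrite -(msize_treeidx _ p); apply: leq_sum.
apply: ler_sum => U /andP[iU UD].
apply: (@le_trans _ _ (\sum_(a : {ffun pairT n -> 'I_D.+1} |
     (msize (ffnat a) <= D)%N && conn i0 (ffnat a) && (verts (ffnat a) :\ i0 == U))
   \sum_(p : {ffun 'I_n -> 'I_n} | arb U p && lef (treeidx U p) (ffnat a)) W (ffnat a))).
  apply: ler_sum => a /andP[/andP[aD ca] /eqP aU].
  have [p [ap tp]] := spanning_arb ca; rewrite aU in ap tp.
  (* One spanning tree pays for [a]; its other spanning trees only add nonnegative terms. *)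
  rewrite (bigD1 p)/=; last by rewrite ap; apply/lefP.
  by rewrite lerDl sumr_ge0.
rewrite (exchange_big_dep (fun p => arb U p)) /=; last by move=> a p _ /andP[].
apply: ler_sum => p ap.
apply: (@le_trans _ _ (rho ^+ (2 * #|U|.+1) * \sum_(a : {ffun pairT n -> 'I_D.+1} |
      lef (treeidx U p) (ffnat a) && (verts (ffnat a) \subset i0 |: U))
    x ^+ msize (ffnat a))); last first.
  by rewrite ler_wpM2l ?exprn_ge0 ?(ltW r0)// sum_above_tree.
rewrite mulr_sumr [leLHS]big_mkcond [leRHS]big_mkcond; apply: ler_sum => a _.
case: ifP => [/andP[/andP[_ /eqP aU] /andP[_ ta]]|_]; last first.
  by case: ifP => // _; rewrite mulr_ge0// exprn_ge0// ltW.
rewrite ta /= -aU root_verts finset.subsetUr /W -root_verts mulrC.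
by rewrite finset.cardsU1 finset.setD11 add1n.
Qed.

(** Distinct trees with [D] edges give distinct multi-indices; their entries are at most 1, so [a!]
    is 1, and they are connected, so the lower bound on kappa applies. *)
Lemma kappa_sum_ge D : 0 < rho < 1 -> 0 <= lam -> 2 ^+ D.+1 * rho <= 1 ->
  ('C(n.-1, D) * D.+1 ^ D.-1)%:R * (lam ^+ D * rho ^+ D.+1 / 2) ^+ 2
  <= kappa_sum rho lam i0 D.
Proof.
move=> r01 l0 Dr; have /andP[r0 r1] := r01.
pose Z : {set {set 'I_n} * {ffun 'I_n -> 'I_n}} :=
  [set z : {set 'I_n} * {ffun 'I_n -> 'I_n} | [&& i0 \notin z.1, #|z.1| == D & arb z.1 z.2]].
pose h (z : {set 'I_n} * {ffun 'I_n -> 'I_n}) : {ffun pairT n -> 'I_D.+1} :=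
  ffinord D (treeidx z.1 z.2).
have hK z : z \in Z -> ffnat (h z) = treeidx z.1 z.2.
  rewrite inE => /and3P[_ /eqP zD _]; apply: ffinordK => e.
  by rewrite -zD -(msize_treeidx z.1 z.2) leq_msize.
have hI : {in Z &, injective h}.
  move=> [U p] [U' p'] zZ zZ' /(congr1 (@ffnat n _)); rewrite !hK//.
  move: zZ zZ'; rewrite !inE /= => /and3P[iU _ ap] /and3P[iU' _ ap'].
  by move=> /(treeidx_inj iU iU' ap ap')[-> ->].
set c := (_ / 2) ^+ 2.
have cZ : \sum_(z in Z) c = ('C(n.-1, D) * D.+1 ^ D.-1)%:R * c.
  pose f (t : nat) : R := if t == D then c else 0.
  have z0 : \sum_(t < D) ('C(n.-1, t) * t.+1 ^ t.-1)%:R * f t = 0.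
    by rewrite big1// => t _; rewrite /f ltn_eqF// mulr0.
  have fD : f D = c by rewrite /f eqxx.
  have := sum_arb D f; rewrite big_ord_recr/= z0 add0r fD => <-; rewrite pair_big_dep/= big_mkcond [RHS]big_mkcond/=.
  apply: eq_bigr => -[U p] _ /=; rewrite inE /f /=.
  have [->|UD] := eqVneq #|U| D; first by rewrite leqnn andbT /=.
  by rewrite andbF; case: ifP.
rewrite -cZ /kappa_sum.
have kge0 (a : {ffun pairT n -> 'I_D.+1}) : 0 <= kap (ffnat a) ^+ 2 / (mfact (ffnat a))%:R.
  by rewrite divr_ge0 ?sqr_ge0.
apply: (@le_trans _ _ (\sum_(a in h @: Z) kap (ffnat a) ^+ 2 / (mfact (ffnat a))%:R)); last first.
  rewrite [leLHS]big_mkcond [leRHS]big_mkcond; apply: ler_sum => a _.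
  case: ifP => [/imsetP[z zZ ->]|_]; last by case: ifP.
  rewrite ifT// hK// msize_treeidx.
  by move: zZ; rewrite inE => /and3P[_ /eqP -> _].
rewrite big_imset//=; apply: ler_sum => z zZ; rewrite hK//.
move: zZ; rewrite inE => /and3P[iU /eqP UD ap].
have -> : mfact (treeidx z.1 z.2) = 1%N.
  rewrite /mfact big1// => e _; have := treeidx_le1 e iU ap.
  by case: (treeidx _ _ e) => [|[|]].
have mD : msize (treeidx z.1 z.2) = D by rewrite msize_treeidx.
have := @kappa_bounds R n rho lam i0 (treeidx z.1 z.2) r01 l0; rewrite mD => /(_ Dr)[_].
move=> /(_ (conn_treeidx iU ap)); rewrite verts_treeidx// finset.cardsU1 iU UD add1n => hk.
have c0 : 0 <= lam ^+ D * rho ^+ D.+1 / 2.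
  by rewrite divr_ge0 ?mulr_ge0 ?exprn_ge0 ?(ltW r0).
by rewrite divr1 /c lerXn2r ?nnegrE// (le_trans c0).
Qed.

End KappaSum.

(** * Numerical conclusions *)

Section Final.
Variables (R : realType).
Implicit Types (rho lam r : R) (n D : nat).

Lemma exp2_le_of_log rho D : 0 < rho ->
  D%:R <= ln (rho^-1) / ln 2 - 1 -> 2 ^+ D.+1 * rho <= 1.
Proof.
move=> r0; rewrite lerBrDr natr1 ler_pdivlMr ?ln_gt0 ?ltr1n// => h.
have : ln (2 ^+ D.+1) <= ln rho^-1 by rewrite lnXn// -(mulr_natl (ln 2)).
rewrite ler_ln ?posrE ?invr_gt0 ?exprn_gt0// => h2.
by rewrite -ler_pdivlMr// mul1r.
Qed.

Lemma regime_bounds rho lam r n D : (0 < n)%N -> 0 < rho -> 0 <= lam -> 0 < r < 1 ->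
  lam <= Num.sqrt (r / (expR 1 * rho ^+ 2 * n%:R)) ->
  D%:R <= Num.sqrt (expR 1 / 3 * r * rho ^+ 2 * n%:R) ->
  expR 1 * n%:R * lam ^+ 2 * rho ^+ 2 <= r /\
  3 * D%:R ^+ 2 * lam ^+ 2 <= r ^+ 2.
Proof.
move=> n0 rho0 lam0 /andP[r0 r1] hl hD.
have e0 : 0 < expR 1 :> R := expR_gt0 1.
have n0' : 0 < n%:R :> R by rewrite ltr0n.
have rr : 0 < rho ^+ 2 by rewrite exprn_gt0.
have P : 0 < expR 1 * rho ^+ 2 * n%:R by rewrite !mulr_gt0.
have Q : 0 <= r / (expR 1 * rho ^+ 2 * n%:R) by rewrite divr_ge0 ?ltW.
have Q2 : 0 <= expR 1 / 3 * r * rho ^+ 2 * n%:R.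
  by apply/ltW; rewrite mulr_gt0// mulr_gt0// mulr_gt0// divr_gt0.
have h1 : lam ^+ 2 <= r / (expR 1 * rho ^+ 2 * n%:R).
  by rewrite -(sqr_sqrtr Q) lerXn2r ?nnegrE ?sqrtr_ge0.
have h2 : D%:R ^+ 2 <= expR 1 / 3 * r * rho ^+ 2 * n%:R.
  by rewrite -(sqr_sqrtr Q2) lerXn2r ?nnegrE ?sqrtr_ge0.
split.
  move: h1; rewrite ler_pdivlMr// => h1; apply: le_trans h1.
  by rewrite le_eqVlt; apply/orP; left; apply/eqP; ring.
have D2 : 0 <= D%:R ^+ 2 :> R by exact: sqr_ge0.
(* Multiplying the bounds on [D^2] and [lam^2] cancels [e], [rho] and [n], leaving [r^2]. *)
apply: (@le_trans _ _ (3 * (expR 1 / 3 * r * rho ^+ 2 * n%:R) * (r / (expR 1 * rho ^+ 2 * n%:R)))).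
  by rewrite ler_pM ?mulr_ge0 ?sqr_ge0// ler_wpM2l.
rewrite le_eqVlt; apply/orP; left; apply/eqP; field.
by rewrite !gt_eqF.
Qed.

Lemma kappa_sum_upper n (i0 : 'I_n) rho lam r D : (0 < D)%N -> 0 < rho < 1 -> 0 <= lam ->
  2 ^+ D.+1 * rho <= 1 -> 0 < r < 1 ->
  expR 1 * n%:R * lam ^+ 2 * rho ^+ 2 <= r -> 3 * D%:R ^+ 2 * lam ^+ 2 <= r ^+ 2 ->
  kappa_sum rho lam i0 D <= 2 * rho ^+ 2 / (1 - r) ^+ 2.
Proof.
move=> D0 rho01 lam0 Drho r01 hr hx.
have /andP[rho0 rho1] := rho01; have /andP[r0 r1] := r01.
set x := lam ^+ 2 in hr hx *.
have x0 : 0 <= x by exact: sqr_ge0.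
have D1 : 1 <= D%:R :> R by rewrite ler1n.
have r21 : r ^+ 2 < 1 by rewrite exprn_ilt1 ?ltW.
have x1 : x < 1.
  apply: le_lt_trans r21; apply: le_trans hx; rewrite ler_peMl//.
  by have := ler_pM ler01 ler01 D1 D1; rewrite -expr2; nra.
have lam1 : lam < 1 by move: x1; rewrite /x expr_lt1.
have r210 : 0 < 1 - r ^+ 2 by rewrite subr_gt0.
have r10 : 0 < 1 - r by rewrite subr_gt0.
have x10 : 0 < 1 - x by rewrite subr_gt0.
have l01 : 0 <= lam < 1 by rewrite lam0.
apply: (le_trans (kappa_sum_le_trees i0 rho01 l01 Drho)); rewrite -/x.
pose f (t : nat) : R := rho ^+ (2 * t.+1) * (x ^+ t * (1 - r ^+ 2)^-1).
apply: (@le_trans _ _ (\sum_(U : {set 'I_n} | (i0 \notin U) && (#|U| <= D)%N)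
     \sum_(p : {ffun 'I_n -> 'I_n} | arbor [set i0] U p) f #|U|)).
  apply: ler_sum => U /andP[iU UD]; apply: ler_sum => p _; rewrite /f.
  rewrite ler_wpM2l ?exprn_ge0 ?(ltW rho0)// ler_wpM2l ?exprn_ge0//.
  rewrite exprVn lef_pV2 ?posrE ?exprn_gt0//.
  (* On [t + 1] vertices there are [(t+1)(t+2)/2] pairs, at most [3 D^2] for [t <= D], with equality
     at [t = D = 1]: the origin of the 3. *)
  apply: le_trans (bernoulli_ge _ _); last by rewrite x0 ltW.
  rewrite lerD2l lerN2; apply: le_trans hx; rewrite ler_wpM2r//.
  rewrite -natrX -natrM ler_nat.
  have := card_inner (i0 |: U); rewrite finset.cardsU1 iU add1n -muln2.
  move: UD D0; clear; set t := #|U|; set M := #|inner _| => tD D0 ME; nia.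
rewrite sum_arb.
apply: (@le_trans _ _ (\sum_(t < D.+1) rho ^+ 2 / (1 - r ^+ 2) * (if (0 <= t)%N then r ^+ t else 0))).
  apply: ler_sum => t _; rewrite leq0n /f.
  (* Multiplied by [t!], the binomial is at most [n^t], and Cayley's factor is at most [e^t t!]. *)
  have h1 : ('C(n.-1, t) * t.+1 ^ t.-1)%:R <= (n%:R * expR 1) ^+ t :> R.
    have tf : 0 < t`!%:R :> R by rewrite ltr0n fact_gt0.
    rewrite -(ler_pM2r tf) -natrM mulnAC bin_ffact natrM exprMn -mulrA.
    rewrite ler_pM// ?natrX.
      by rewrite -natrX ler_nat (leq_trans (ffact_upper _ _))// leq_exp2rW// leq_pred.
    apply: le_trans (expS_le_expR_fact _ _).
    by rewrite ler_weXn2l ?ler1n// leq_pred.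
  have -> : rho ^+ (2 * t.+1) = rho ^+ 2 * (rho ^+ 2) ^+ t.
    by rewrite exprM exprS.
  apply: (@le_trans _ _ ((n%:R * expR 1) ^+ t * (rho ^+ 2 * (rho ^+ 2) ^+ t * (x ^+ t / (1 - r ^+ 2))))).
    by rewrite ler_wpM2r// !mulr_ge0 ?exprn_ge0 ?invr_ge0 ?(ltW r210) ?(ltW rho0).
  have -> : (n%:R * expR 1) ^+ t * (rho ^+ 2 * (rho ^+ 2) ^+ t * (x ^+ t / (1 - r ^+ 2))) =
    rho ^+ 2 / (1 - r ^+ 2) * (expR 1 * n%:R * x * rho ^+ 2) ^+ t.
    by rewrite !exprMn; ring.
  rewrite ler_wpM2l ?divr_ge0 ?exprn_ge0 ?(ltW r210) ?(ltW rho0)//.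
  by rewrite lerXn2r ?nnegrE ?(ltW r0)// !mulr_ge0 ?expR_ge0 ?(ltW rho0).
rewrite -mulr_sumr.
have r01' : 0 <= r < 1 by rewrite ltW.
have c0 : 0 <= rho ^+ 2 / (1 - r ^+ 2) by rewrite divr_ge0 ?sqr_ge0 ?ltW.
apply: (le_trans (ler_wpM2l c0 (geometric_tail_le 0 D.+1 r01'))).
have -> : rho ^+ 2 / (1 - r ^+ 2) * (r ^+ 0 / (1 - r)) = rho ^+ 2 * ((1 - r ^+ 2) * (1 - r))^-1.
  by rewrite expr0 mul1r -mulrA invfM.
have -> : 2 * rho ^+ 2 / (1 - r) ^+ 2 = rho ^+ 2 * (2 / (1 - r) ^+ 2) by ring.
rewrite ler_wpM2l ?sqr_ge0//.
  rewrite ler_pdivlMr ?exprn_gt0//.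
  (* The bound obtained is the target with [1/(1+r)] in place of 2. *)
  have -> : ((1 - r ^+ 2) * (1 - r))^-1 * (1 - r) ^+ 2 = (1 + r)^-1.
    by field; rewrite !gt_eqF// ?subr_gt0// addr_gt0.
  by rewrite (@le_trans _ _ 1)// ?ler1n// invf_le1 ?lerDl ?ltW// addr_gt0.
Qed.

Lemma kappa_sum_lower n (i0 : 'I_n) rho lam D : 0 < rho < 1 -> 0 <= lam ->
  (0 < D)%N -> 2 ^+ D.+1 * rho <= 1 -> (D <= n - 1)%N ->
  rho ^+ 2 / (4 * expR 1 * powR D%:R (3 / 2))
       * (expR 1 * lam ^+ 2 * rho ^+ 2 * (n%:R - D%:R)) ^+ D
     <= kappa_sum rho lam i0 D.
Proof.
move=> rho01 lam0 D0 Drho Dn; have /andP[rho0 rho1] := rho01.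
apply: le_trans (kappa_sum_ge i0 rho01 lam0 Drho).
have e0 : 0 < expR 1 :> R := expR_gt0 1.
have D0' : 0 < D%:R :> R by rewrite ltr0n.
have s0 : 0 < Num.sqrt D%:R :> R by rewrite sqrtr_gt0.
have -> : powR D%:R (3 / 2) = D%:R * Num.sqrt D%:R :> R.
  have -> : 3 / 2 = 1 + 2^-1 :> R by field.
  rewrite powRD; last by rewrite (gt_eqF D0') implybT.
  by rewrite powRr1 ?powR12_sqrt ?ltW.
have Dn' : (D <= n)%N by rewrite (leq_trans Dn)// leq_subr.
(* Here [D <= n - 1] makes [(n-1) - D + 1] equal [n - D]. Stirling leaves [e sqrt(D) D^D], and
   replacing [D^(D-1)] by Cayley's [(D+1)^(D-1)] leaves [e D^(3/2)]. *)
have key : (expR 1 * (n%:R - D%:R)) ^+ D <=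
    ('C(n.-1, D) * D.+1 ^ D.-1)%:R * (expR 1 * (D%:R * Num.sqrt D%:R)) :> R.
  have f0 : 0 < D`!%:R :> R by rewrite ltr0n fact_gt0.
  have h1 : (n%:R - D%:R) ^+ D <= 'C(n.-1, D)%:R * D`!%:R :> R.
    rewrite -natrB// -natrX -natrM ler_nat bin_ffact.
    apply: leq_trans (ffact_lower _); last by rewrite -subn1.
    by rewrite -subn1 -subnDA addnC subnDA subn1 prednK// subn_gt0; lia.
  rewrite exprMn; apply: (@le_trans _ _ (expR 1 ^+ D * ('C(n.-1, D)%:R * D`!%:R))).
    by rewrite ler_wpM2l ?exprn_ge0 ?(ltW e0).
  have -> : expR 1 ^+ D * ('C(n.-1, D)%:R * D`!%:R) = 'C(n.-1, D)%:R * (D`!%:R * expR 1 ^+ D) :> R.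
    by ring.
  rewrite natrM -[leRHS]mulrA ler_wpM2l//.
  apply: (le_trans (fact_le_stirling R D0)).
  have -> : D%:R ^+ D = D%:R * D%:R ^+ D.-1 :> R by rewrite -exprS prednK.
  have -> : expR 1 * Num.sqrt D%:R * (D%:R * D%:R ^+ D.-1) =
     D%:R ^+ D.-1 * (expR 1 * (D%:R * Num.sqrt D%:R)) :> R by ring.
  have hD1 : D%:R ^+ D.-1 <= (D.+1 ^ D.-1)%:R :> R by rewrite -natrX ler_nat leq_exp2rW.
  by rewrite ler_wpM2r// mulr_ge0 ?mulr_ge0 ?(ltW e0).
set N := ('C(_, _) * _)%:R in key *.
have -> : (expR 1 * lam ^+ 2 * rho ^+ 2 * (n%:R - D%:R)) ^+ D =
   (expR 1 * (n%:R - D%:R)) ^+ D * (lam ^+ D * rho ^+ D) ^+ 2.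
  have -> : (lam ^+ D * rho ^+ D) ^+ 2 = (lam ^+ 2 * rho ^+ 2) ^+ D.
    by rewrite -!exprMn exprAC.
  by rewrite -exprMn; congr (_ ^+ _); ring.
(* The 4 is the square of the factor 1/2 lost in the lower bound on kappa. *)
have -> : N * (lam ^+ D * rho ^+ D.+1 / 2) ^+ 2 =
   rho ^+ 2 / 4 * N * (lam ^+ D * rho ^+ D) ^+ 2.
  by rewrite (exprS rho D); clearbody N; move: (lam ^+ D) (rho ^+ D) => a b; field.
rewrite mulrA ler_wpM2r ?sqr_ge0//.
rewrite -mulrA invfM mulrA -[leRHS]mulrA -mulrA ler_wpM2l ?divr_ge0 ?sqr_ge0//.
have P : 0 < expR 1 * (D%:R * Num.sqrt D%:R) :> R by rewrite !mulr_gt0.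
move: key; rewrite -ler_pdivrMr// => key.
apply: le_trans (ler_wpM2l (_ : 0 <= 4^-1) key) => //.
by rewrite !invfM le_eqVlt; apply/orP; left; apply/eqP; ring.
Qed.

End Final.

Theorem mainTheorem18 (R : realType) (n : nat) (hn : (0 < n)%N) (rho lam : R) :
  0 < rho < 1 -> 0 <= lam ->
  (forall (r : R) (D : nat),
     0 < r < 1 ->
     lam <= Num.sqrt (r / (expR 1 * rho ^+ 2 * n%:R)) ->
     (1 <= D)%N ->
     D%:R <= ln (rho^-1) / ln 2 - 1 ->
     D%:R <= Num.sqrt (expR 1 / 3 * r * rho ^+ 2 * n%:R) ->
     CorrD rho lam (Ordinal hn) D ^+ 2 <= 2 * rho ^+ 2 / (1 - r) ^+ 2) /\
  (forall D : nat,
     (1 <= D)%N ->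
     D%:R <= ln (rho^-1) / ln 2 - 1 ->
     (D <= n - 1)%N ->
     rho ^+ 2 / (4 * expR 1 * powR D%:R (3 / 2))
       * (expR 1 * lam ^+ 2 * rho ^+ 2 * (n%:R - D%:R)) ^+ D
     <= kappa_sum rho lam (Ordinal hn) D).
Proof.
move=> rho01 lam0; have /andP[rho0 rho1] := rho01.
have rho01' : 0 <= rho <= 1 by rewrite !ltW.
split=> [r D r01 hlam D0 hD hD2|D D0 hD Dn].
  have hD' := exp2_le_of_log rho0 hD.
  apply: (le_trans (CorrD_sqr_le _ _ _ rho01')).
  have [x1 x2] := regime_bounds hn rho0 lam0 r01 hlam hD2.
  exact: kappa_sum_upper.
exact: (kappa_sum_lower _ rho01 lam0 D0 (exp2_le_of_log rho0 hD) Dn).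
Qed.
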